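(* Let $\Theta=\sum_{k\ge1}\Theta_k\in\mathrm{Hom}(\bar{\mathrm T}(V^\bullet),\mathfrak g^\bullet)$ be a homotopy embedding tensor on an $L_\infty$-algebra $(\mathfrak g^\bullet,\{l_k\}_{k\ge1})$ with respect to a representation $(V^\bullet,\{\rho_k\}_{k\ge1})$. (i) $e^{[\cdot,\Theta]_{\mathsf B}}\sum_{k\ge1}(l_k\boxplus\rho_k)$ is a Maurer-Cartan element of the graded Lie algebra $(\mathbf C^\bullet(\mathfrak g^\bullet\oplus V^\bullet,\mathfrak g^\bullet\oplus V^\bullet),[\cdot,\cdot]_{\mathsf B})$. (ii) There is a Leibniz$_\infty$-algebra structure $\{\theta_k\}_{k\ge1}$ on $V^\bullet$ given by $$\theta_k(v_1,\dots,v_k)=\Big(e^{[\cdot,\Theta]_{\mathsf B}}\sum_{j\ge1}(l_j\boxplus\rho_j)\Big)(v_1,\dots,v_k),\qquad v_1,\dots,v_k\in V^\bullet.$$ (iii) The association in (ii) (sending a strict homomorphism $(\phi_{\mathfrak g^\bullet},\phi_{V^\bullet})$ to $\phi_{V^\bullet}$) gives rise to a functor $S$ from the category of homotopy embedding tensors to that of Leibniz$_\infty$-algebras.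
   Context: Ground field of characteristic $0$; graded means $\mathbb Z$-graded; exponents of $-1$ denote degrees; $\varepsilon(\sigma)$ is the Koszul sign; $\mathbb S_{(i,j)}$ is the set of $(i,j)$-shuffles; $\bar{\mathrm T}(V)=\bigoplus_{i\ge1}V^{\otimes i}$. Graded Balavoine bracket: for a graded space $E^\bullet$, $\mathbf C^n(E,E)=\mathrm{Hom}^n(\bar{\mathrm T}(E),E)$ (degree $n$ maps $f=\sum_{i\ge1} f_i$, $f_i:\otimes^iE\to E$). For $f\in\mathbf C^m,g\in\mathbf C^n$: $[f,g]_{\mathsf B}=f\bar\circ g-(-1)^{mn}g\bar\circ f$, $f\bar\circ g=\sum_{i,j}\sum_{k=1}^if_i\bar\circ_kg_j$, with $s=i+j-1$ and $$(f_i\bar\circ_kg_j)(v_1,\dots,v_s)=\sum_{\sigma\in\mathbb S_{(k-1,j-1)}}(-1)^{n(v_{\sigma(1)}+\dots+v_{\sigma(k-1)})}\varepsilon(\sigma)f_i\big(v_{\sigma(1)},\dots,v_{\sigma(k-1)},g_j(v_{\sigma(k)},\dots,v_{\sigma(k+j-2)},v_{k+j-1}),v_{k+j},\dots,v_s\big).$$ This is a graded Lie algebra; its Maurer-Cartan elements are degree $1$ elements $\Delta$ with $[\Delta,\Delta]_{\mathsf B}=0$. A Leibniz$_\infty$-algebra is a graded space $\mathfrak G^\bullet$ with degree $1$ maps $\theta_k:\otimes^k\mathfrak G\to\mathfrak G$, $k\ge1$, such that $\sum_k\theta_k$ is a Maurer-Cartan element of $(\mathbf C^\bullet(\mathfrak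 G,\mathfrak G),[\cdot,\cdot]_{\mathsf B})$. A homomorphism $(\mathfrak G,\{\theta_k\})\to(\mathfrak G',\{\theta'_k\})$ is a collection of degree $0$ maps $f_k:\otimes^k\mathfrak G\to\mathfrak G'$ such that for all $n\ge1$ $$\sum_{i=1}^n\sum_{k=1}^{n-i+1}\sum_{\sigma\in\mathbb S_{(k-1,i-1)}}(-1)^{x_{\sigma(1)}+\dots+x_{\sigma(k-1)}}\varepsilon(\sigma)f_{n-i+1}(x_{\sigma(1)},\dots,x_{\sigma(k-1)},\theta_i(x_{\sigma(k)},\dots,x_{\sigma(k+i-2)},x_{k+i-1}),x_{k+i},\dots,x_n)$$ $$=\sum_{p=1}^n\sum_{k_1+\dots+k_p=n}\sum_{\sigma\in\mathbb E_{(k_1,\dots,k_p)}}\varepsilon(\sigma)\theta'_p\big(f_{k_1}(x_{\sigma(1)},\dots,x_{\sigma(k_1)}),\dots,f_{k_p}(x_{\sigma(n-k_p+1)},\dots,x_{\sigma(n)})\big),$$ $\mathbb E_{(k_1,\dots,k_p)}$ being the $(k_1,\dots,k_p)$-shuffles with $\sigma(k_1)<\sigma(k_1+k_2)<\dots<\sigma(k_1+\dots+k_p)$. A single degree $0$ linear map $f_1$ commuting with all structure maps (with $f_k=0$ for $k\ge2$) is a strict homomorphism. An $L_\infty$-algebra is a graded space $\mathfrak g^\bullet$ with degree $1$ graded symmetric maps $l_k:\mathrm S^k(\mathfrak g)\to\mathfrak g$ with $\sum_{i=1}^n\sum_{\sigma\in\mathbb S_{(i,n-i)}}\varepsilon(\sigma)l_{n-i+1}(l_i(x_{\sigma(1)},\dots,x_{\sigma(i)}),x_{\sigma(i+1)},\dots,x_{\sigma(n)})=0$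 for all $n\ge 1$. For degree $1$ maps $\rho_k:\mathrm S^{k-1}(\mathfrak g)\otimes V\to V$, put $(l_k\boxplus\rho_k)((x_1,v_1),\dots,(x_k,v_k))=(l_k(x_1,\dots,x_k),\rho_k(x_1,\dots,x_{k-1},v_k))$. $(V,\{\rho_k\})$ is a representation of $(\mathfrak g,\{l_k\})$ precisely when $\{l_k\boxplus\rho_k\}_{k\ge1}$ is a Leibniz$_\infty$-algebra structure on $\mathfrak g\oplus V$. Homotopy embedding tensor: $\mathfrak h=\bigoplus_n\mathrm{Hom}^n(\bar{\mathrm T}(V),\mathfrak g)$ is viewed inside $\mathbf C^\bullet(\mathfrak g\oplus V,\mathfrak g\oplus V)$ by extending by zero, and $P$ is the projection of $\mathbf C^\bullet(\mathfrak g\oplus V,\mathfrak g\oplus V)$ onto $\mathfrak h$ (the components with all inputs in $V$ and output in $\mathfrak g$). A degree $0$ element $\Theta=\sum_k\Theta_k\in\mathfrak h$ is a homotopy embedding tensor if $P\big(e^{[\cdot,\Theta]_{\mathsf B}}\sum_k(l_k\boxplus\rho_k)\big)=0$, where $e^{[\cdot,\Theta]_{\mathsf B}}\Delta=\sum_{r\ge0}\frac1{r!}[\cdots[[\Delta,\Theta]_{\mathsf B},\Theta]_{\mathsf B},\cdots,\Theta]_{\mathsf B}$ ($r$ brackets; the sum is finite in each arity). Category of homotopy embedding tensors: a morphism from $\Theta'$ to $\Theta$, both on the same $(\mathfrak g^\bullet,\{l_k\})$ with respect to the same $(V^\bullet,\{\rho_k\})$, is a strict homomorphism: a degree $0$ linear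 map $\phi_{\mathfrak g}:\mathfrak g\to\mathfrak g$ commuting with all $l_k$ and a degree $0$ linear map $\phi_V:V\to V$ with $\phi_{\mathfrak g}(\Theta'_n(v_1,\dots,v_n))=\Theta_n(\phi_V(v_1),\dots,\phi_V(v_n))$ and $\phi_V(\rho_n(x_1,\dots,x_{n-1},u))=\rho_n(\phi_{\mathfrak g}(x_1),\dots,\phi_{\mathfrak g}(x_{n-1}),\phi_V(u))$ for all $n\ge1$. *)

(* Defs.v *)
From HB Require Import structures.
From mathcomp Require Import all_boot all_order all_algebra all_fingroup.
From mathcomp Require Import finmap boolp classical_sets functions cardinality fsbigop.

Set Implicit Arguments.
Unset Strict Implicit.
Unset Printing Implicit Defensive.

Import GRing.Theory.
Local Open Scope ring_scope.

(* A Z-graded space is its total space [E = \bigoplus_d E^d], presented by the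
   projections onto the homogeneous components. *)
Record gradedSpace (K : fieldType) := GradedSpace {
  gsort :> lmodType K;
  gproj : int -> {linear gsort -> gsort};
  gproj_ortho : forall (d e : int) (x : gsort),
    gproj d (gproj e x) = if d == e then gproj e x else 0;
  gproj_finite : forall x : gsort, finite_set [set d | gproj d x != 0]%classic;
  gproj_sum : forall x : gsort, \sum_(d \in [set: int]%classic) gproj d x = x
}.

Definition homog (K : fieldType) (E : gradedSpace K) (d : int) (x : E) : bool :=
  gproj E d x == x.

Definition homogs (K : fieldType) (E : gradedSpace K)
    (ds : seq int) (v : seq E) : bool :=
  all2 (@homog K E) ds v.

Definition parity (d : int) : bool := odd `|d|%N.

(* The component of [x] in the even ([b = false]) or odd ([b = true]) part. *)
Definition parity_part (K : fieldType) (E : gradedSpace K) (b : bool) (x : E) : E :=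
  \sum_(d \in [set d | parity d = b]%classic) gproj E d x.

Section DirectSum.
Context (K : fieldType) (E F : gradedSpace K).

Definition gsum_proj (d : int) (x : E * F) : E * F :=
  (gproj E d x.1, gproj F d x.2).

Fact gsum_proj_linear (d : int) : linear (gsum_proj d).
Proof. by move=> a [x1 x2] [y1 y2]; rewrite /gsum_proj /= !linearP. Qed.

HB.instance Definition _ (d : int) :=
  GRing.isLinear.Build K (E * F)%type (E * F)%type *:%R (gsum_proj d)
    (gsum_proj_linear d).

Fact gsum_ortho (d e : int) (x : E * F) :
  gsum_proj d (gsum_proj e x) = if d == e then gsum_proj e x else 0.
Proof. by rewrite /gsum_proj /= !gproj_ortho; case: eqP. Qed.

Fact gsum_finite (x : E * F) :
  finite_set [set d | gsum_proj d x != 0]%classic.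
Proof.
apply: (@sub_finite_set _ _
  ([set d | gproj E d x.1 != 0] `|` [set d | gproj F d x.2 != 0])%classic).
  move=> d /=; case: (eqVneq (gproj E d x.1) 0) => [e1|]; last by left.
  case: (eqVneq (gproj F d x.2) 0) => [e2|]; last by right.
  by rewrite /gsum_proj e1 e2 eqxx.
by rewrite finite_setU; split; apply: gproj_finite.
Qed.

Fact gsum_sum (x : E * F) :
  \sum_(d \in [set: int]%classic) gsum_proj d x = x.
Proof.
have /finite_fsetP[A eA] := gsum_finite x.
have out d : d \notin A -> gsum_proj d x = 0.
  move=> dA; apply/eqP; apply: contraNT dA => dx.
  have : [set` A]%classic d by rewrite -eA.
  by [].
rewrite (fsbigTE A) //.
have := gproj_sum x.1; have := gproj_sum x.2.
rewrite !(fsbigTE A); last 2 first.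
- by move=> d /out [].
- by move=> d /out [].
move=> e2 e1; rewrite [RHS]surjective_pairing -e1 -e2.
elim: (finmap.enum_fset A) => [|d s IH]; first by rewrite !big_nil.
by rewrite !big_cons IH.
Qed.

Definition gsum : gradedSpace K :=
  @GradedSpace K (E * F)%type gsum_proj gsum_ortho gsum_finite gsum_sum.

End DirectSum.

(* A family [f = \sum_(i >= 1) f_i] of maps [f_i] on [i] arguments is one
   function on lists, [f_i] being its restriction to lists of size [i]. *)
Definition multilinear (K : fieldType) (E F : lmodType K) (f : seq E -> F) : Prop :=
  forall (s t : seq E) (a : K) (x y : E),
    f (s ++ (a *: x + y) :: t) = a *: f (s ++ x :: t) + f (s ++ y :: t).

(* [f] is an element of [Hom^n (\bar T(E), F)]; the empty list, which is no
   argument of [f], is sent to [0] by convention. *)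
Definition is_cochain (K : fieldType) (E F : gradedSpace K) (n : int)
    (f : seq E -> F) : Prop :=
  [/\ f [::] = 0, multilinear f &
      forall (ds : seq int) (v : seq E),
        homogs ds v -> homog (n + \sum_(d <- ds) d) (f v)].

Definition permvals (n : nat) (s : 'S_n) : seq nat :=
  [seq val (s i) | i <- enum 'I_n].

(* [v_(s 0), v_(s 1), ...] *)
Definition permseq (T : Type) (x0 : T) (n : nat) (s : 'S_n) (v : seq T) : seq T :=
  [seq nth x0 v i | i <- permvals s].

Definition shuffle (ks : seq nat) (n : nat) (s : 'S_n) : bool :=
  all (sorted ltn) (reshape ks (permvals s)).

(* The shuffles for which the last values in the blocks are increasing. *)
Definition Eshuffle (ks : seq nat) (n : nat) (s : 'S_n) : bool :=
  shuffle ks s && sorted ltn [seq last 0%N b | b <- reshape ks (permvals s)].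

(* The Koszul sign of [s] on arguments with parities [p]:
   [v_0 ... v_(n-1) = koszul s p * v_(s 0) ... v_(s (n-1))] in [S(E)]. *)
Definition koszul (K : fieldType) (n : nat) (s : 'S_n) (p : seq bool) : K :=
  \prod_(i < n) \prod_(j < n | (i < j)%N && (s j < s i)%N)
    (-1) ^+ (nth false p (s i) && nth false p (s j)).

(* A formula [T p v], meant for homogeneous arguments [v] with parities [p], is
   extended to all arguments by splitting them into even and odd parts. *)
Definition multi_ext (K : fieldType) (E : gradedSpace K) (F : lmodType K)
    (T : seq bool -> seq E -> F) (v : seq E) : F :=
  \sum_(p : (size v).-tuple bool) T p [seq parity_part bx.1 bx.2 | bx <- zip p v].

(* [f_i \bar\circ_k g_j] for [g] of degree [n], on arguments with parities [p],
   where [a = k - 1], [b = j - 1], and [i = size v - b]. *)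
Definition balavoine_term (K : fieldType) (E : gradedSpace K) (F : lmodType K)
    (n : int) (a b : nat) (f : seq E -> F) (g : seq E -> E)
    (p : seq bool) (v : seq E) : F :=
  \sum_(s : 'S_(a + b) | shuffle [:: a; b] s)
    ((-1) ^+ (parity n && odd (count id (take a (permseq false s p)))) * koszul K s p) *:
    f (take a (permseq 0 s v) ++
       g (rcons (drop a (permseq 0 s v)) (nth 0 v (a + b))) :: drop (a + b).+1 v).

Definition balavoine_formula (K : fieldType) (E : gradedSpace K) (F : lmodType K)
    (n : int) (f : seq E -> F) (g : seq E -> E) (p : seq bool) (v : seq E) : F :=
  \sum_(b < size v) \sum_(a < size v - b) balavoine_term n a b f g p v.

Definition balavoine_circ (K : fieldType) (E : gradedSpace K) (n : int)
    (f g : seq E -> E) : seq E -> E :=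
  multi_ext (balavoine_formula n f g).

(* [[f, g]_B] for [f] of degree [m] and [g] of degree [n] *)
Definition balavoine_bracket (K : fieldType) (E : gradedSpace K) (m n : int)
    (f g : seq E -> E) (v : seq E) : E :=
  balavoine_circ n f g v - (-1) ^+ (parity m && parity n) *: balavoine_circ m g f v.

Definition is_MC (K : fieldType) (E : gradedSpace K) (D : seq E -> E) : Prop :=
  is_cochain 1 D /\ forall v : seq E, balavoine_bracket 1 1 D D v = 0.

(* [e^([., Theta]_B) D] for [D] of degree [1] and [Theta] of degree [0]; on each
   [v], the sum is over the [r] giving a nonzero term. *)
Definition exp_bracket (K : fieldType) (E : gradedSpace K)
    (Theta D : seq E -> E) (v : seq E) : E :=
  \sum_(r \in [set: nat]%classic)
    (r`!%:R)^-1 *: iter r (fun D' => balavoine_bracket 1 0 D' Theta) D v.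

Record leibnizInfty (K : fieldType) := LeibnizInfty {
  leib_space :> gradedSpace K;
  leib_op : seq leib_space -> leib_space;
  leib_opP : is_MC leib_op
}.

(* [\sum_p \sum_(k_1 + ... + k_p = n) \sum_s
     koszul s * h_p (f_(k_1) (...), ..., f_(k_p) (...))] *)
Definition infty_comp_formula (K : fieldType) (E F : gradedSpace K) (G : lmodType K)
    (h : seq F -> G) (f : seq E -> F) (p : seq bool) (v : seq E) : G :=
  let n := size v in
  \sum_(1 <= q < n.+1)
    \sum_(k : q.-tuple 'I_n.+1 |
        (sumn (map val k) == n) && all (fun i : 'I_n.+1 => 0 < i)%N k)
      \sum_(s : 'S_n | Eshuffle (map val k) s)
        koszul K s p *: h (map f (reshape (map val k) (permseq 0 s v))).

Definition is_infty_hom (K : fieldType) (A B : leibnizInfty K)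
    (f : seq A -> B) : Prop :=
  is_cochain 0 f /\
  forall (ds : seq int) (v : seq A), (0 < size v)%N -> homogs ds v ->
    balavoine_formula 1 f (@leib_op K A) (map parity ds) v =
    infty_comp_formula (@leib_op K B) f (map parity ds) v.

Definition infty_comp (K : fieldType) (A B C : gradedSpace K)
    (h : seq B -> C) (f : seq A -> B) : seq A -> C :=
  multi_ext (infty_comp_formula h f).

(* [f_1 = phi] and [f_k = 0] for [k >= 2] *)
Definition strict_family (K : fieldType) (A B : gradedSpace K) (phi : A -> B)
    (v : seq A) : B :=
  if v is [:: x] then phi x else 0.

Definition graded_symmetric (K : fieldType) (E : gradedSpace K) (F : lmodType K)
    (f : seq E -> F) : Prop :=
  forall (ds : seq int) (v : seq E) (s : 'S_(size v)), homogs ds v ->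
    f v = koszul K s (map parity ds) *: f (permseq 0 s v).

Record LInfty (K : fieldType) := MkLInfty {
  linf_space :> gradedSpace K;
  linf_op : seq linf_space -> linf_space;
  linf_cochain : is_cochain 1 linf_op;
  linf_sym : graded_symmetric linf_op;
  linf_rel : forall (ds : seq int) (v : seq linf_space),
    (0 < size v)%N -> homogs ds v ->
    \sum_(1 <= i < (size v).+1)
      \sum_(s : 'S_(size v) | shuffle [:: i; (size v - i)%N] s)
        koszul K s (map parity ds) *:
        linf_op (linf_op (take i (permseq 0 s v)) :: drop i (permseq 0 s v)) = 0
}.

(* [(l_k \boxplus rho_k)_k], where [rho xs u] is [rho_k] for [k = size xs + 1] *)
Definition boxplus (K : fieldType) (g V : gradedSpace K)
    (l : seq g -> g) (rho : seq g -> V -> V) (w : seq (gsum g V)) : gsum g V :=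
  if w is z :: w' then
    (l (map fst (z :: w')), rho (map fst (belast z w')) (last z w').2)
  else 0.

Record LInftyRep (K : fieldType) (g : LInfty K) := MkLInftyRep {
  rep_space :> gradedSpace K;
  rep_op : seq g -> rep_space -> rep_space;
  rep_linear : forall xs : seq g, linear (rep_op xs);
  rep_multilinear : forall u : rep_space,
    @multilinear K g rep_space (fun xs => rep_op xs u);
  rep_sym : forall u : rep_space,
    @graded_symmetric K g rep_space (fun xs => rep_op xs u);
  rep_degree : forall (ds : seq int) (e : int) (xs : seq g) (u : rep_space),
    homogs ds xs -> homog e u -> homog (1 + \sum_(d <- ds) d + e) (rep_op xs u);
  rep_leibniz : is_MC (boxplus (@linf_op K g) rep_op)
}.

Definition inV (K : fieldType) (g V : gradedSpace K) (u : V) : gsum g V := (0, u).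

Definition extend0 (K : fieldType) (g V : gradedSpace K) (Theta : seq V -> g)
    (w : seq (gsum g V)) : gsum g V :=
  (Theta (map snd w), 0).

(* The projection [P], with values in [Hom (\bar T(V), g)]. *)
Definition projh (K : fieldType) (g V : gradedSpace K)
    (f : seq (gsum g V) -> gsum g V) (v : seq V) : g :=
  (f (map (@inV K g V) v)).1.

Definition twisted (K : fieldType) (g : LInfty K) (V : LInftyRep g)
    (Theta : seq V -> g) : seq (gsum g V) -> gsum g V :=
  exp_bracket (extend0 Theta) (boxplus (@linf_op K g) (@rep_op K g V)).

Record embeddingTensor (K : fieldType) (g : LInfty K) (V : LInftyRep g) :=
  EmbeddingTensor {
    et_map :> seq V -> g;
    et_cochain : is_cochain 0 et_map;
    et_eq : forall v : seq V, projh (twisted et_map) v = 0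
  }.

Definition induced_op (K : fieldType) (g : LInfty K) (V : LInftyRep g)
    (Theta : embeddingTensor V) (v : seq V) : V :=
  (twisted Theta (map (@inV K g V) v)).2.

Record is_et_hom (K : fieldType) (g : LInfty K) (V : LInftyRep g)
    (Theta' Theta : embeddingTensor V) (phi : (g -> g) * (V -> V)) : Prop := {
  eth_linear1 : linear phi.1;
  eth_linear2 : linear phi.2;
  eth_degree1 : forall (d : int) (x : g), homog d x -> homog d (phi.1 x);
  eth_degree2 : forall (d : int) (u : V), homog d u -> homog d (phi.2 u);
  eth_linf : forall xs : seq g,
    phi.1 (linf_op xs) = linf_op (map phi.1 xs);
  eth_tensor : forall v : seq V, phi.1 (Theta' v) = Theta (map phi.2 v);
  eth_rep : forall (xs : seq g) (u : V),
    phi.2 (rep_op xs u) = rep_op (map phi.1 xs) (phi.2 u)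
}.

(* The data of a category. The morphisms from [x] to [y] are the [a : arr x y]
   satisfying [is_arr]; [comp_arr b a] is [b] after [a]. *)
Record category_data := CategoryData {
  obj :> Type;
  arr : obj -> obj -> Type;
  is_arr : forall x y : obj, arr x y -> Prop;
  id_arr : forall x : obj, arr x x;
  comp_arr : forall x y z : obj, arr y z -> arr x y -> arr x z
}.

Definition is_functor (C D : category_data) (SO : C -> D)
    (SA : forall x y : C, arr x y -> arr (SO x) (SO y)) : Prop :=
  [/\ forall (x y : C) (a : arr x y), is_arr a -> is_arr (SA x y a),
      forall x : C, SA x x (id_arr x) = id_arr (SO x) &
      forall (x y z : C) (b : arr y z) (a : arr x y), is_arr b -> is_arr a ->
        SA x z (comp_arr b a) = comp_arr (SA y z b) (SA x y a)].

Definition et_category (K : fieldType) (g : LInfty K) (V : LInftyRep g) :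
    category_data :=
  {| obj := embeddingTensor V;
     arr := fun _ _ => ((g -> g) * (V -> V))%type;
     is_arr := @is_et_hom K g V;
     id_arr := fun _ => (id, id);
     comp_arr := fun _ _ _ b a => (b.1 \o a.1, b.2 \o a.2) |}.

Definition leibniz_category (K : fieldType) : category_data :=
  {| obj := leibnizInfty K;
     arr := fun A B => seq A -> B;
     is_arr := @is_infty_hom K;
     id_arr := fun A => strict_family (@id A);
     comp_arr := fun A B C h f => infty_comp h f |}.

Lemma gproj_homog (K : fieldType) (E : gradedSpace K) (d e : int) (x : E) :
  homog d x -> gproj E e x = if e == d then x else 0.
Proof. by move=> /eqP hx; rewrite -{1}hx gproj_ortho hx. Qed.

Lemma parity_part_homog (K : fieldType) (E : gradedSpace K) (b : bool) (d : int)
    (x : E) : homog d x -> parity_part b x = if parity d == b then x else 0.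
Proof.
move=> hx; rewrite /parity_part; case: (eqVneq (parity d) b) => [db|db].
  rewrite -(fsbig_widen [set d]%classic).
  - by rewrite fsbig_set1 (gproj_homog _ hx) eqxx.
  - by move=> e /= ->.
  - by move=> e [/= _ /eqP ed]; rewrite /= (gproj_homog _ hx) (negbTE ed).
apply: fsbig1 => e /= eb; rewrite (gproj_homog _ hx); case: eqP => // ed.
by rewrite -ed eb eqxx in db.
Qed.

Lemma multilinear0 (K : fieldType) (E F : lmodType K) (f : seq E -> F) (v : seq E) :
  multilinear f -> 0 \in v -> f v = 0.
Proof.
move=> fL /splitPr[s t]; have := fL s t (-1) 0 0.
by rewrite scaler0 addr0 scaleN1r addNr.
Qed.

Lemma multi_ext_homog (K : fieldType) (E : gradedSpace K) (F : lmodType K)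
    (T : seq bool -> seq E -> F) (ds : seq int) (v : seq E) :
    (forall p w, 0 \in w -> T p w = 0) -> homogs ds v ->
  multi_ext T v = T (map parity ds) v.
Proof.
move=> T0 hv; have szd : size ds = size v.
  by move: hv; rewrite /homogs all2E => /andP[/eqP ->].
have part (p : seq bool) : size p = size v ->
    [seq parity_part bx.1 bx.2 | bx <- zip p v] =
    [seq if parity dbx.1 == dbx.2.1 then dbx.2.2 else 0 | dbx <- zip ds (zip p v)].
  rewrite /homogs in hv; elim: ds v hv {szd} p => [|d ds IH] [|x v] //=; first by move=> _ [].
  move=> /andP[hx hv] [|b p] //= [sp].
  by rewrite (parity_part_homog _ hx) (IH v hv).
have sp : size (map parity ds) == size v by rewrite size_map szd.
rewrite /multi_ext (bigD1 (Tuple sp)) //= big1 ?addr0.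
  congr (T _ _); rewrite part ?(eqP sp) // => {T0 hv part sp T}.
  by elim: ds v szd => [|d ds IH] [|x v] //= [szd]; rewrite eqxx IH.
move=> p pN; apply: T0; rewrite part ?size_tuple //.
have {pN} : tval p != map parity ds.
  by apply: contra pN => /eqP e; apply/eqP/val_inj.
case: p => /= p /eqP szp pN; elim: ds v {hv sp part} p szd szp pN => [|d ds IH] [|x v] [|b p] //= [szd] [szp].
rewrite eqseq_cons negb_and in_cons => /orP[|/(IH _ _ szd szp) ->]; last exact: orbT.
by rewrite eq_sym => /negbTE ->; rewrite eqxx.
Qed.

Lemma mem0_permseq (K : fieldType) (E : lmodType K) (n : nat) (s : 'S_n)
    (v : seq E) (i : nat) : (i < n)%N -> nth 0 v i = 0 -> 0 \in permseq 0 s v.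
Proof.
move=> i_n vi0; apply/mapP; exists i; last by [].
by apply/mapP; exists ((s^-1)%g (Ordinal i_n)); rewrite ?mem_enum // permKV.
Qed.

Lemma balavoine_formula0 (K : fieldType) (E : gradedSpace K) (F : lmodType K)
    (n : int) (f : seq E -> F) (g : seq E -> E) (p : seq bool) (w : seq E) :
  multilinear f -> multilinear g -> 0 \in w -> balavoine_formula n f g p w = 0.
Proof.
move=> fL gL /(nthP 0)[i i_w wi0]; apply: big1 => b _; apply: big1 => a _.
have ltab : (a + b < size w)%N by have := ltn_ord a; rewrite ltn_subRL addnC.
apply: big1 => s _; rewrite (multilinear0 fL) ?scaler0 //.
rewrite mem_cat in_cons; case: (ltngtP i (a + b)%N) => [lti|gti|eqi].
- have := mem0_permseq s lti wi0; rewrite -{1}(cat_take_drop a (permseq 0 s w)).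
  rewrite mem_cat => /orP[-> //|w0]; rewrite [g _](multilinear0 gL) ?eqxx ?orbT //.
  by rewrite mem_rcons in_cons w0 orbT.
- suff -> : 0 \in drop (a + b).+1 w by rewrite !orbT.
  rewrite -wi0 -(subnKC gti) -nth_drop mem_nth // size_drop ltn_sub2r //.
  exact: leq_ltn_trans gti i_w.
- rewrite [g _](multilinear0 gL) ?eqxx ?orbT //.
  by rewrite mem_rcons in_cons; move: wi0; rewrite {1}eqi => ->; rewrite eqxx.
Qed.

Lemma balavoine_circ_homog (K : fieldType) (E : gradedSpace K) (n : int)
    (f g : seq E -> E) (ds : seq int) (v : seq E) :
    multilinear f -> multilinear g -> homogs ds v ->
  balavoine_circ n f g v = balavoine_formula n f g (map parity ds) v.
Proof.
by move=> fL gL; apply: multi_ext_homog => p w; apply: balavoine_formula0.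
Qed.

Lemma infty_comp_homog (K : fieldType) (A B C : gradedSpace K)
    (h : seq B -> C) (f : seq A -> B) (ds : seq int) (v : seq A) :
    multilinear h -> multilinear f -> homogs ds v ->
  infty_comp h f v = infty_comp_formula h f (map parity ds) v.
Proof.
move=> hL fL; apply: multi_ext_homog => p w /(nthP 0)[i i_w wi0].
apply: big1 => q _; apply: big1 => k /andP[/eqP sumk _]; apply: big1 => s _.
rewrite (multilinear0 hL) ?scaler0 //.
have := mem0_permseq s i_w wi0; rewrite -{1}(@reshapeKr _ (map val k) (permseq 0 s w)).
  by case/flattenP => u uk u0; rewrite -(multilinear0 fL u0); apply: map_f.
by rewrite sumk /permseq /permvals 2!size_map size_enum_ord.
Qed.

(* Main.v *)
Require Import Defs.
From HB Require Import structures.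
From mathcomp Require Import all_boot all_order all_algebra all_fingroup.
From mathcomp Require Import finmap.
From mathcomp Require Import boolp classical_sets functions cardinality fsbigop.
From mathcomp Require Import zify.

Set Implicit Arguments.
Unset Strict Implicit.
Unset Printing Implicit Defensive.

Import GRing.Theory.
Local Open Scope ring_scope.

(** On homogeneous lists the Balavoine product of [f] and [g] is [R_g f], where
    the operator [R_g] is given by recursion on the list of arguments: either [g]
    is applied to the first argument [x] alone, or [x] is one of several arguments
    of [g], or [x] is left to [f]:
      [R_g f (x, w) = f (g x, w) + (R_(g (x, -)) f) w +- (R_g (f (x, -))) w].
    With this recursion the graded pre-Lie identity is an induction on the list.
    It makes [[-, Theta]] a derivation of the bracket of odd elements, so that, for
    [D] Maurer-Cartan and [e_r = [.. [D, Theta] .., Theta] / r!], the sums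
    [S_k = \sum_(i + j = k) [e_i, e_j]] satisfy [S_0 = 0] and
    [(k + 1) S_(k+1) = [S_k, Theta]]; hence they all vanish and [\sum_r e_r] is
    Maurer-Cartan. The sum is finite, as every insertion of [Theta] replaces entries
    outside of [g] by one entry in [g]. All constructions are natural with respect
    to even linear maps intertwining the structures. For the inclusion of [V],
    which intertwines by the equation of a homotopy embedding tensor, this gives the
    structure on [V]; for [phi_g (+) phi_V] it gives the functor. *)

(** * Insertion by recursion *)

Lemma parityD (a b : int) : parity (a + b) = parity a (+) parity b.
Proof. rewrite /parity; lia. Qed.

Definition ksign (K : fieldType) (m n : int) : K := (-1) ^+ (parity m && parity n).

Lemma ksignC (K : fieldType) (m n : int) : ksign K m n = ksign K n m.
Proof. by rewrite /ksign andbC. Qed.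

Lemma ksignDl (K : fieldType) (m n q : int) :
  ksign K (m + n) q = ksign K m q * ksign K n q.
Proof. by rewrite /ksign parityD andb_addl signr_addb. Qed.

Lemma ksignDr (K : fieldType) (m n q : int) :
  ksign K q (m + n) = ksign K q m * ksign K q n.
Proof. by rewrite ![ksign K q _]ksignC ksignDl. Qed.

Lemma ksignKK (K : fieldType) (m n : int) : ksign K m n * ksign K m n = 1.
Proof. by rewrite /ksign -signr_addb addbb. Qed.

Section Insertion.
Context (K : fieldType) (E : lmodType K).

(* A list entry [(d, x)] carries its degree [d], which only serves to compute
   signs; [n] is the degree of [g]. *)
Fixpoint insertion (F : lmodType K) (n : int) (g : seq (int * E) -> E)
    (phi : seq (int * E) -> F) (w : seq (int * E)) : F :=
  if w is x :: w' then
    phi ((n + x.1, g [:: x]) :: w') + insertion (n + x.1) (fun u => g (x :: u)) phi w'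
    + ksign K n x.1 *: insertion n g (fun u => phi (x :: u)) w'
  else 0.

Definition lmultilinear (F : lmodType K) (phi : seq (int * E) -> F) : Prop :=
  forall (s t : seq (int * E)) (d : int) (a : K) (x y : E),
    phi (s ++ (d, a *: x + y) :: t) = a *: phi (s ++ (d, x) :: t) + phi (s ++ (d, y) :: t).

Lemma lmultilinear_cons (F : lmodType K) (phi : seq (int * E) -> F) (x : int * E) :
  lmultilinear phi -> lmultilinear (fun u => phi (x :: u)).
Proof. by move=> phiL s t d a y z; rewrite -!cat_cons phiL. Qed.

Lemma lmultilinear_head (F : lmodType K) (phi : seq (int * E) -> F) d a x y t :
  lmultilinear phi ->
  phi ((d, a *: x + y) :: t) = a *: phi ((d, x) :: t) + phi ((d, y) :: t).
Proof. by move=> phiL; have := phiL [::] t d a x y. Qed.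

Lemma insertion_linearl (F : lmodType K) n g (phi psi : seq (int * E) -> F) a w :
  insertion n g (fun u => a *: phi u + psi u) w =
  a *: insertion n g phi w + insertion n g psi w.
Proof.
elim: w n g phi psi => [|x w IH] n g phi psi /=; first by rewrite scaler0 addr0.
rewrite !IH !scalerDr !scalerA [a * _]mulrC.
by rewrite [RHS](AC (3*3) ((1*4)*(2*5)*(3*6))).
Qed.

Lemma insertion_linearr (F : lmodType K) n g g' (phi : seq (int * E) -> F) a w :
  lmultilinear phi ->
  insertion n (fun u => a *: g u + g' u) phi w =
  a *: insertion n g phi w + insertion n g' phi w.
Proof.
elim: w n g g' phi => [|x w IH] n g g' phi phiL /=; first by rewrite scaler0 addr0.
rewrite lmultilinear_head // !IH //; last exact: lmultilinear_cons.
rewrite !scalerDr !scalerA [a * _]mulrC.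
by rewrite [RHS](AC (3*3) ((1*4)*(2*5)*(3*6))).
Qed.

(** Both summands of the modified entry carry the same degree [d], so all signs agree. Induction on
    the prefix [s] brings that entry to the head, where each of the three terms of the recursion is
    linear in it. *)
Lemma insertion_multilinear (F : lmodType K) n g (phi : seq (int * E) -> F) :
  lmultilinear g -> lmultilinear phi -> lmultilinear (insertion n g phi).
Proof.
move=> gL phiL s; elim: s n g phi gL phiL => [|z s IH] n g phi gL phiL t d a x y /=.
  have -> : g [:: (d, a *: x + y)] = a *: g [:: (d, x)] + g [:: (d, y)].
    exact: lmultilinear_head.
  have -> : (fun u => g ((d, a *: x + y) :: u)) =
      (fun u => a *: g ((d, x) :: u) + g ((d, y) :: u)).
    by apply/funext => u; apply: lmultilinear_head.
  have -> : (fun u => phi ((d, a *: x + y) :: u)) =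
      (fun u => a *: phi ((d, x) :: u) + phi ((d, y) :: u)).
    by apply/funext => u; apply: lmultilinear_head.
  rewrite lmultilinear_head // insertion_linearl insertion_linearr //.
  rewrite !scalerDr !scalerA [a * _]mulrC.
  by rewrite [RHS](AC (3*3) ((1*4)*(2*5)*(3*6))).
rewrite -!cat_cons phiL !IH //; try exact: lmultilinear_cons.
rewrite !scalerDr !scalerA [a * _]mulrC.
by rewrite [RHS](AC (3*3) ((1*4)*(2*5)*(3*6))).
Qed.

Lemma insertion_funD n g g' (F : lmodType K) (phi : seq (int * E) -> F) w :
  lmultilinear phi ->
  insertion n (fun u => g u + g' u) phi w =
  insertion n g phi w + insertion n g' phi w.
Proof.
move=> phiL; rewrite -[X in _ = X + _]scale1r -insertion_linearr //.
by congr insertion; apply/funext => u; rewrite scale1r.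
Qed.

Lemma insertion_funZ n g (F : lmodType K) (phi : seq (int * E) -> F) a w :
  lmultilinear phi ->
  insertion n (fun u => a *: g u) phi w = a *: insertion n g phi w.
Proof.
elim: w n g phi => [|x w IH] n g phi phiL /=; first by rewrite scaler0.
have -> : phi ((n + x.1, a *: g [:: x]) :: w) = a *: phi ((n + x.1, g [:: x]) :: w).
  (* The instance [a = -1], [x = y = 0] of linearity shows that [phi] vanishes on a zero entry. *)
  have := lmultilinear_head (n + x.1) (-1) 0 0 w phiL.
  rewrite scaler0 addr0 scaleN1r addNr => phi0.
  by rewrite -[a *: _]addr0 lmultilinear_head // phi0 addr0.
rewrite !IH //; last exact: lmultilinear_cons.
by rewrite !scalerDr !scalerA [_ * a]mulrC.
Qed.

Lemma insertion_preD n g (F : lmodType K) (phi psi : seq (int * E) -> F) w :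
  insertion n g (fun u => phi u + psi u) w = insertion n g phi w + insertion n g psi w.
Proof.
rewrite -[X in _ = X + _]scale1r -insertion_linearl //.
by congr insertion; apply/funext => u; rewrite scale1r.
Qed.

Lemma insertion_preZ n g (F : lmodType K) (phi : seq (int * E) -> F) a w :
  insertion n g (fun u => a *: phi u) w = a *: insertion n g phi w.
Proof.
elim: w n g phi => [|x w IH] n g phi /=; first by rewrite scaler0.
by rewrite !IH // !scalerDr !scalerA [_ * a]mulrC.
Qed.

(** The associator [(phi o f) o g - phi o (f o g)] of the product [phi o f = R_f phi]. *)
Definition insertion_assoc (F : lmodType K) m f n g (phi : seq (int * E) -> F) w : F :=
  insertion n g (insertion m f phi) w - insertion (m + n) (insertion n g f) phi w.

(** Expand both halves of the associator at [x]. The terms in which [f] takes [g x] as its first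
    argument occur in both halves and cancel. What remains has [g x] or [f x] as first argument of
    [phi], or [x] joined to the arguments of [g] or of [f], or [x] left to [phi]. *)
Lemma insertion_assoc_cons (F : lmodType K) m f n g (phi : seq (int * E) -> F) x w :
  lmultilinear phi ->
  insertion_assoc m f n g phi (x :: w) =
    (ksign K m (n + x.1) *: insertion m f (fun u => phi ((n + x.1, g [:: x]) :: u)) w
     + ksign K n x.1 *: insertion n g (fun u => phi ((m + x.1, f [:: x]) :: u)) w)
    + (insertion_assoc m f (n + x.1) (fun u => g (x :: u)) phi w
    + ksign K n x.1 *: insertion_assoc (m + x.1) (fun u => f (x :: u)) n g phi w)
    + ksign K (m + n) x.1 *: insertion_assoc m f n g (fun u => phi (x :: u)) w.
Proof.
move=> phiL; rewrite /insertion_assoc /=.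
rewrite !scaler0 !addr0 !insertion_preD !insertion_funD // insertion_preZ insertion_funZ //.
rewrite !addrA [m + n + x.1]addrAC ksignDl !scalerBr !scalerDr !scalerA.
rewrite [ksign K m x.1 * _]mulrC.
rewrite opprD !opprD !addrA.
(* The reordering brings the two cancelling pairs to the front. *)
rewrite [LHS](ACl (1*8*2*9*3*5*4*10*6*11*7*12)) /=.
by rewrite subrr add0r subrr add0r.
Qed.

(* Both sides of the identity satisfy the recursion of [insertion_assoc_cons],
   which is symmetric under the exchange of [f] and [g]. *)
Lemma insertion_preLie (F : lmodType K) m f n g (phi : seq (int * E) -> F) w :
  lmultilinear f -> lmultilinear g -> lmultilinear phi ->
  insertion_assoc m f n g phi w = ksign K m n *: insertion_assoc n g m f phi w.
Proof.
elim: w m f n g phi => [|x w IH] m f n g phi fL gL phiL.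
  by rewrite /insertion_assoc /= subr0 scaler0.
rewrite !insertion_assoc_cons //.
rewrite (IH m f (n + x.1)) ?(IH (m + x.1) _ n) ?(IH m f n) //; try exact: lmultilinear_cons.
move: (insertion_assoc n g m f _ w) (insertion_assoc n g (m + x.1) _ _ w)
  (insertion_assoc (n + x.1) _ m f _ w) => t1 t2 t3.
rewrite !scalerDr !scalerA !ksignDl !ksignDr.
rewrite [ksign K n m]ksignC !mulrA ksignKK !mul1r.
congr (_ + _ + _); first by rewrite addrC.
  by rewrite addrC [ksign K x.1 n]ksignC [_ * ksign K m n]mulrC -mulrA ksignKK mulr1.
by rewrite [_ * ksign K m n]mulrC [ksign K m x.1 * _]mulrC mulrA.
Qed.

End Insertion.

Section InsertionRelation.
Context (K : fieldType) (E E' F F' : lmodType K) (R : F -> F' -> Prop).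
Hypotheses (R0 : R 0 0)
  (RD : forall x x' y y', R x x' -> R y y' -> R (x + y) (x' + y'))
  (RZ : forall (a : K) x x', R x x' -> R (a *: x) (a *: x')).

(** Up to sign, every summand of an insertion is [phi] on a rearrangement [A ++ B ++ C] of [w] in
    which the nonempty block [B] is replaced by its value under [g]. A relation stable under linear
    combinations therefore passes from the summands to the whole. The choices of [R] below give
    homogeneity, locality, naturality and vanishing. *)
Lemma insertion_rel (h : E -> E') (n : int) g g' (phi : seq (int * E) -> F)
    (phi' : seq (int * E') -> F') (w : seq (int * E)) :
  let H := map (fun x => (x.1, h x.2)) in
  (forall A B C, perm_eq (A ++ B ++ C) w -> (0 < size B)%N ->
    R (phi (A ++ (n + \sum_(x <- B) x.1, g B) :: C))
      (phi' (H A ++ (n + \sum_(x <- B) x.1, g' (H B)) :: H C))) ->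
  R (insertion n g phi w) (insertion n g' phi' (H w)).
Proof.
move=> H; rewrite /H; elim: w n g g' phi phi' => [|x w IH] n g g' phi phi' RP //=.
apply: RD; first apply: RD.
- by have := RP [::] [:: x] w; rewrite big_seq1; apply.
- apply: IH => A B C ABC B0; have := RP A (x :: B) C; rewrite big_cons addrA; apply => //.
  by rewrite perm_catCA /= perm_cons perm_catCA.
apply/RZ/IH => A B C ABC B0; apply: (RP (x :: A) B C) => //.
by rewrite /= perm_cons.
Qed.

End InsertionRelation.

(** * Shuffles as masks *)

Fixpoint masks (m : nat) : seq bitseq :=
  if m is m'.+1 then map (cons true) (masks m') ++ map (cons false) (masks m')
  else [:: [::]].

Lemma mem_masks (m : nat) (mu : bitseq) : (mu \in masks m) = (size mu == m).
Proof.
have cons_mem b b' nu s : (b :: nu \in map (cons b') s) = (b == b') && (nu \in s).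
  apply/mapP/andP => [[nu' nus [-> ->]]|[/eqP -> nus]]; first by rewrite eqxx.
  by exists nu.
elim: m mu => [|m IH] [|b mu] //=; last first.
  by rewrite mem_cat !cons_mem IH eqSS; case: b => //=; rewrite orbF.
by rewrite mem_cat; apply/negP => /orP[] /mapP[].
Qed.

Lemma masks_uniq (m : nat) : uniq (masks m).
Proof.
elim: m => //= m IH; rewrite cat_uniq !map_inj_uniq ?IH /= ?andbT; try by move=> ? ? [].
by apply/hasPn => mu /mapP[nu _ ->]; apply/mapP => -[].
Qed.

Lemma mask_take_size (T : Type) (mu : bitseq) (s : seq T) :
  mask mu (take (size mu) s) = mask mu s.
Proof. by elim: mu s => [|b mu IH] [|x s] //=; rewrite IH. Qed.

Lemma map_nth_mask_iota (T : Type) (x0 : T) (v : seq T) (k : nat) (mu : bitseq) :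
  (k + size mu <= size v)%N ->
  [seq nth x0 v i | i <- mask mu (iota k (size mu))] = mask mu (drop k v).
Proof.
move=> kv; rewrite map_mask map_nth_iota ?mask_take_size //.
by rewrite leq_subRL //; apply: leq_trans kv; apply: leq_addr.
Qed.

Lemma size_mask_leq (T : Type) (mu : bitseq) (v : seq T) :
  (size mu <= size v)%N -> size (mask mu v) = count id mu.
Proof. by move=> mv; rewrite -mask_take_size size_mask // size_takel. Qed.

(** On [iota] this is the value list of the shuffle encoded by [mu]: the bits [true] mark the values
    of the first block. *)
Definition mask_perm (mu : bitseq) (s : seq nat) : seq nat :=
  mask mu s ++ mask (map negb mu) s.

Lemma map_nth_mask_perm (T : Type) (x0 : T) (v : seq T) (mu : bitseq) :
  (size mu <= size v)%N ->
  [seq nth x0 v i | i <- mask_perm mu (iota 0 (size mu))] =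
  mask mu v ++ mask (map negb mu) v.
Proof.
move=> mv; rewrite map_cat map_nth_mask_iota // drop0; congr (_ ++ _).
by rewrite -(size_map negb) map_nth_mask_iota ?size_map // drop0.
Qed.

(** Recovers a block of a shuffle, which is sorted, from its set of values. *)
Lemma sorted_iota_eq (m : nat) (s : seq nat) :
  {subset s <= iota 0 m} -> sorted ltn s -> [seq i <- iota 0 m | i \in s] = s.
Proof.
move=> sm ss; apply: (irr_sorted_eq ltn_trans ltnn) => //.
  by apply: sorted_filter; [apply: ltn_trans|apply: iota_ltn_sorted].
move=> i; rewrite mem_filter; apply: andb_idr; exact: sm.
Qed.

Lemma size_permvals (n : nat) (s : 'S_n) : size (permvals s) = n.
Proof. by rewrite size_map size_enum_ord. Qed.

Lemma nth_permvals (n : nat) (s : 'S_n) (i : 'I_n) : nth 0%N (permvals s) i = s i.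
Proof. by rewrite (nth_map i) ?size_enum_ord // nth_ord_enum. Qed.

Lemma permvals_inj (n : nat) : injective (@permvals n).
Proof.
move=> s t st; apply/permP => i; apply/val_inj.
by rewrite /= -!nth_permvals st.
Qed.

Lemma permvals_perm (n : nat) (s : 'S_n) : perm_eq (permvals s) (iota 0 n).
Proof.
apply: uniq_perm; rewrite ?iota_uniq //.
  by rewrite map_inj_uniq ?enum_uniq // => i j /val_inj /perm_inj.
move=> i; rewrite mem_iota add0n /=; apply/mapP/idP => [[j _ ->]|im]; first exact: ltn_ord.
by exists ((s^-1)%g (Ordinal im)); rewrite ?mem_enum // permKV.
Qed.

Lemma perm_permvals (n : nat) (l : seq nat) :
  perm_eq l (iota 0 n) -> exists s : 'S_n, permvals s = l.
Proof.
move=> ln; case/tuple_permP: (ln : perm_eq l (iota_tuple n 0)) => s ->; exists s.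
rewrite /permvals /=; apply: eq_map => i.
by rewrite (tnth_nth 0%N) nth_iota // add0n.
Qed.

Lemma mask_perm_iota (m : nat) (mu : bitseq) :
  size mu = m -> perm_eq (mask_perm mu (iota 0 m)) (iota 0 m).
Proof.
rewrite /mask_perm; elim: mu m 0%N => [|[] mu IH] [|m] k //= [] szm.
  by rewrite perm_cons IH.
by rewrite perm_catC /= perm_cons perm_catC IH.
Qed.

(* A shuffle in [S_(a+b)] is determined by the set of its first [a] values. *)
Lemma big_shuffle (M : nmodType) (a b : nat) (F : seq nat -> M) :
  \sum_(s : 'S_(a + b) | shuffle [:: a; b] s) F (permvals s) =
  \sum_(mu <- masks (a + b) | count id mu == a) F (mask_perm mu (iota 0 (a + b))).
Proof.
rewrite -[LHS]big_filter -[RHS]big_filter.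
rewrite -(big_map (@permvals _) xpredT F).
rewrite -(big_map (fun mu => mask_perm mu (iota 0 (a + b))) xpredT F).
have size_count (mu : bitseq) (s : seq nat) : size mu = size s ->
    size (mask mu s) = count id mu by apply: size_mask.
apply: perm_big; apply: uniq_perm.
- by rewrite map_inj_uniq ?filter_uniq ?index_enum_uniq //; apply: permvals_inj.
- rewrite map_inj_in_uniq ?filter_uniq ?masks_uniq // => mu nu.
  rewrite !mem_filter !mem_masks => /andP[/eqP ca /eqP sm] /andP[/eqP cn /eqP sn].
  move=> /(congr1 (take a)).
  rewrite /mask_perm !take_size_cat ?size_count ?size_iota // => e.
  apply: (@eq_from_nth _ false) => [|i im]; first by rewrite sm sn.
  rewrite sm in im.
  (* Bit [i] of a mask tells whether [i] lies in the first block, so equal first blocks come from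
     equal masks. *)
  have := congr1 (fun s => i \in s) e; rewrite !in_mask ?iota_uniq // mem_iota add0n im /=.
  have := @index_uniq _ 0%N i (iota 0 (a + b)).
  by rewrite size_iota iota_uniq nth_iota // add0n => ->.
move=> l; apply/mapP/mapP => [[s]|[mu]]; rewrite mem_filter.
  case/andP=> sh _ ->; set l0 := permvals s.
  have pl : perm_eq l0 (iota 0 (a + b)) := permvals_perm s.
  have ul : uniq l0 by rewrite (perm_uniq pl) iota_uniq.
  have szl : size l0 = (a + b)%N := size_permvals s.
  move: sh; rewrite /shuffle /= -/l0 (@take_oversize _ b) ?size_drop ?szl ?addKn // andbT.
  case/andP=> s1 s2.
  have sub1 : {subset take a l0 <= iota 0 (a + b)}.
    by move=> i /mem_take; rewrite (perm_mem pl).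
  have sub2 : {subset drop a l0 <= iota 0 (a + b)}.
    by move=> i /mem_drop; rewrite (perm_mem pl).
  (* The mask of a shuffle marks the values in its first block. *)
  exists [seq i \in take a l0 | i <- iota 0 (a + b)].
    rewrite mem_filter mem_masks size_map size_iota eqxx andbT.
    rewrite count_map -size_filter (eq_filter (a2 := mem (take a l0))) //.
    by rewrite sorted_iota_eq // size_takel ?szl ?leq_addr.
  rewrite /mask_perm -map_comp -!filter_mask sorted_iota_eq //.
  rewrite (_ : filter _ _ = drop a l0) ?cat_take_drop //.
  rewrite -[RHS](sorted_iota_eq sub2 s2); apply: eq_in_filter => i.
  rewrite -(perm_mem pl) -{1}(cat_take_drop a l0) mem_cat /=.
  move: ul; rewrite -{1}(cat_take_drop a l0) cat_uniq => /and3P[_ /hasPn ul _].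
  case: (boolP (i \in drop a l0)) => [/ul /= /negbTE -> //|_].
  by rewrite orbF => ->.
case/andP=> /eqP ca; rewrite mem_masks => /eqP sm ->.
have [s sl] := perm_permvals (mask_perm_iota sm).
exists s; last by rewrite sl.
rewrite mem_filter mem_index_enum andbT /shuffle sl /=.
have sza : size (mask mu (iota 0 (a + b))) = a by rewrite size_count ?size_iota.
rewrite /mask_perm take_size_cat // drop_size_cat //.
have szb : size (mask (map negb mu) (iota 0 (a + b))) = b.
  have := perm_size (mask_perm_iota sm).
  by rewrite /mask_perm size_cat sza size_iota => /addnI.
rewrite (@take_oversize _ b) ?szb // andbT.
by rewrite !(sorted_mask ltn_trans) ?iota_ltn_sorted.
Qed.

(** The exponent of the Koszul sign: the number of inversions between odd arguments, modulo 2. *)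
Fixpoint inversion_parity (p : seq bool) (l : seq nat) : bool :=
  if l is x :: l' then
    (nth false p x && odd (count (fun y => (y < x)%N && nth false p y) l'))
    (+) inversion_parity p l'
  else false.

Lemma koszulE (K : fieldType) (n : nat) (s : 'S_n) (p : seq bool) :
  koszul K s p = (-1) ^+ inversion_parity p (permvals s).
Proof.
(* Arbitrary lists of values are needed, as the tail of a permutation is no permutation. *)
have gen (l : seq nat) :
    \prod_(i < size l) \prod_(j < size l | (i < j)%N && (nth 0 l j < nth 0 l i)%N)
      (-1) ^+ (nth false p (nth 0 l i) && nth false p (nth 0 l j))
    = (-1) ^+ inversion_parity p l :> K.
  elim: l => [|x l IH]; first by rewrite big_ord0.
  rewrite [size _]/= big_ord_recl [inversion_parity _ _]/= signr_addb -IH; congr (_ * _).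
    rewrite big_mkcond big_ord_recl /= mul1r -big_mkcond /=.
    transitivity (\prod_(y <- l | (y < x)%N) (-1) ^+ (nth false p x && nth false p y) : K).
      by rewrite (big_nth 0%N) big_mkord.
    elim: l {IH} => [|y l IHl]; first by rewrite big_nil andbF.
    rewrite big_cons IHl /= oddD; case: ltnP => //= _.
    by rewrite oddb andb_addr signr_addb.
  apply: eq_bigr => i _.
  by rewrite big_mkcond big_ord_recl /= mul1r -big_mkcond.
rewrite -gen /koszul size_permvals.
by apply: eq_bigr => i _; rewrite nth_permvals; apply: eq_big => j; rewrite nth_permvals.
Qed.

(** The same exponent read off the mask: an odd entry of the second block is inverted exactly with
    the later odd entries of the first block. *)
Fixpoint mask_inversion (mu : bitseq) (p : seq bool) : bool :=
  match mu, p with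
  | b :: mu', x :: p' =>
    (~~ b && x && odd (count id (mask mu' p'))) (+) mask_inversion mu' p'
  | _, _ => false
  end.

(** The least value [k] is inverted exactly with the entries in front of it. *)
Lemma inversion_parity_cat (p : seq bool) (k : nat) (l1 l2 : seq nat) :
  all (ltn k) l1 -> all (ltn k) l2 ->
  inversion_parity p (l1 ++ k :: l2) =
  (nth false p k && odd (count (nth false p) l1)) (+) inversion_parity p (l1 ++ l2).
Proof.
move=> kl1 kl2; elim: l1 kl1 => [_|x l1 IH /= /andP[kx kl1]] /=.
  rewrite (eq_in_count (a2 := pred0)) ?count_pred0 // => y /(allP kl2) /= ky.
  by rewrite ltnNge ltnW.
rewrite {}IH // !count_cat /= kx !oddD !oddb.
move: (odd _) (odd _) (odd _) (inversion_parity _ _) => [] [] [] [].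
all: by case: (nth false p x); case: (nth false p k).
Qed.

(** Induction on the mask, the offset [k] being the least value left. If marked, it comes first and
    creates no inversion; if not, it stands right after the first block, which is the case of
    [inversion_parity_cat]. *)
Lemma inversion_parity_mask (p : seq bool) (k : nat) (mu : bitseq) :
  (k + size mu <= size p)%N ->
  inversion_parity p (mask_perm mu (iota k (size mu))) = mask_inversion mu (drop k p).
Proof.
elim: mu k => [|b mu IH] k kp; first by [].
have kp' : (k < size p)%N.
  by apply: leq_trans kp; rewrite -addSnnS leq_addr.
rewrite /= in kp; rewrite -addSnnS in kp.
rewrite (drop_nth false kp') /= -IH //.
have gt (nu : bitseq) : all (ltn k) (mask nu (iota k.+1 (size mu))).
  by apply/allP => i /mem_mask; rewrite mem_iota => /andP[].
case: b => /=.
  rewrite (eq_in_count (a2 := pred0)) ?count_pred0 ?andbF // => y.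
  rewrite mem_cat => /orP[] /(allP (gt _)) /= ky; by rewrite ltnNge ltnW.
rewrite /mask_perm /= inversion_parity_cat //; congr (_ && odd _ (+) _).
by rewrite -(map_nth_mask_iota false) // count_map; apply: eq_count.
Qed.

(** Used twice: with [m = a + b] the position of the last argument of the inner map, and for the
    Cauchy product of the exponential series with itself. *)
Lemma exchange_triangle (M : nmodType) (n : nat) (X : nat -> nat -> M) :
  \sum_(b < n) \sum_(a < n - b) X a b = \sum_(m < n) \sum_(a < m.+1) X a (m - a)%N.
Proof.
elim: n => [|n IH]; first by rewrite !big_ord0.
rewrite [RHS]big_ord_recr /= -IH.
have -> : \sum_(a < n.+1) X a (n - a)%N = \sum_(b < n.+1) X (n - b)%N b.
  rewrite (reindex_inj rev_ord_inj); apply: eq_bigr => i _ /=.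
  by rewrite subSS subKn // -ltnS.
rewrite big_ord_recr [in RHS]big_ord_recr /= subSnn subnn big_ord_recl big_ord0 addr0.
rewrite addrA -big_split /=; congr (_ + _); apply: eq_bigr => b _.
by rewrite subSn 1?ltnW // big_ord_recr.
Qed.

(** * Comparison of the recursion with the shuffle formula *)

Section Unrolled.
Context (K : fieldType) (E F : lmodType K).

(** Here [n] is the degree of [g] together with the arguments absorbed so far. An entry marked
    [true] stays in front of [g] and is exchanged with all of that. *)
Fixpoint mask_sign (n : int) (mu : bitseq) (w : seq (int * E)) : bool :=
  match mu, w with
  | b :: mu', x :: w' =>
    if b then (parity n && parity x.1) (+) mask_sign n mu' w'
    else mask_sign (n + x.1) mu' w'
  | _, _ => false
  end.

(** The accumulated sign splits into the two signs of the Balavoine product: the map of degree [n]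
    passes the arguments in front of it, and these are shuffled past the absorbed ones. *)
Lemma mask_signE (n : int) (mu : bitseq) (w : seq (int * E)) :
  let p := map (fun x => parity x.1) w in
  mask_sign n mu w = (parity n && odd (count id (mask mu p))) (+) mask_inversion mu p.
Proof.
elim: mu w n => [|b mu IH] [|x w] n //=; rewrite ?andbF //.
rewrite !IH; case: b => /=; first by rewrite oddD oddb andb_addr addbA.
by rewrite parityD andb_addl addbA.
Qed.

(** The recursion stops at the position [m] of the last argument of [g]. For each earlier entry,
    [mu] records whether it was left to [phi] ([true]) or absorbed by [g] ([false]). *)
Lemma insertion_masks (n : int) (g : seq (int * E) -> E) (phi : seq (int * E) -> F)
    (w : seq (int * E)) :
  insertion n g phi w =
  \sum_(m < size w) \sum_(mu <- masks m)
    let B := rcons (mask (map negb mu) w) (nth (0, 0) w m) in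
    (-1) ^+ mask_sign n mu w *:
      phi (mask mu w ++ (n + \sum_(x <- B) x.1, g B) :: drop m.+1 w).
Proof.
elim: w n g phi => [|x w IH] n g phi; first by rewrite big_ord0.
rewrite /= big_ord_recl /= big_seq1 /= scale1r big_seq1 drop0 !IH -addrA; congr (_ + _).
rewrite scaler_sumr -big_split /=; apply: eq_bigr => m _.
rewrite /bump /= add1n /= big_cat /= !big_map /= addrC scaler_sumr; congr (_ + _).
  by apply: eq_bigr => mu _; rewrite scalerA /ksign signr_addb.
by apply: eq_bigr => mu _; rewrite /= big_cons addrA.
Qed.

End Unrolled.

Definition lift_cochain (K : fieldType) (E F : lmodType K) (f : seq E -> F)
    (w : seq (int * E)) : F := f (map snd w).

(** With [a] entries in front of [g] and [b] absorbed before its last argument, that argument has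
    position [m = a + b]. By [big_shuffle] the shuffles become the masks of length [m] with [a] bits
    [true], and summing over [a] gives all masks of length [m]. *)
Lemma balavoine_formula_insertion (K : fieldType) (E : gradedSpace K) (F : lmodType K)
    (n : int) (f : seq E -> F) (g : seq E -> E) (w : seq (int * E)) :
  balavoine_formula n f g (map (fun x => parity x.1) w) (map snd w) =
  insertion n (lift_cochain g) (lift_cochain f) w.
Proof.
rewrite insertion_masks /balavoine_formula size_map.
set p := map _ w; set v := map _ w.
pose G mu := (-1) ^+ mask_sign n mu w *:
  f (mask mu v ++ g (rcons (mask (map negb mu) v) (nth 0 v (size mu))) :: drop (size mu).+1 v).
transitivity (\sum_(b < size w) \sum_(a < size w - b)
    \sum_(mu <- masks (a + b) | count id mu == a) G mu).
  apply: eq_bigr => b _; apply: eq_bigr => a _.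
  have abw : (a + b < size w)%N by have := ltn_ord a; rewrite ltn_subRL addnC.
  rewrite /balavoine_term.
  pose H l := ((-1) ^+ (parity n && odd (count id (take a [seq nth false p i | i <- l])))
     * (-1) ^+ inversion_parity p l : K) *:
    f (take a [seq nth 0 v i | i <- l] ++
       g (rcons (drop a [seq nth 0 v i | i <- l]) (nth 0 v (a + b))) :: drop (a + b).+1 v).
  transitivity (\sum_(s : 'S_(a + b) | shuffle [:: val a; val b] s) H (permvals s)).
    by apply: eq_bigr => s _; rewrite koszulE.
  rewrite big_shuffle big_seq_cond [RHS]big_seq_cond; apply: eq_bigr => mu.
  rewrite mem_masks => /andP[/eqP sm /eqP ca]; rewrite /H /G -{}sm in abw *.
  have sv : (size mu <= size v)%N by rewrite size_map ltnW.
  have sp : (size mu <= size p)%N by rewrite size_map ltnW.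
  rewrite !map_nth_mask_perm // !take_size_cat ?size_mask_leq // drop_size_cat ?size_mask_leq //.
  by rewrite inversion_parity_mask // drop0 -signr_addb -mask_signE.
rewrite (exchange_triangle _ (fun a b => \sum_(mu <- masks (a + b) | count id mu == a) G mu)).
apply: eq_bigr => m _.
transitivity (\sum_(mu <- masks m) G mu).
  transitivity (\sum_(a < m.+1) \sum_(mu <- masks m | count id mu == a) G mu).
    by apply: eq_bigr => a _; rewrite subnKC // -ltnS.
  rewrite (exchange_big_dep xpredT) //= big_seq [RHS]big_seq; apply: eq_bigr => mu.
  rewrite mem_masks => /eqP sm.
  have cm : (count id mu < m.+1)%N by rewrite ltnS -sm count_size.
  by rewrite (big_pred1 (Ordinal cm)) // => a; rewrite eq_sym -val_eqE.
rewrite big_seq [RHS]big_seq; apply: eq_bigr => mu; rewrite mem_masks => /eqP sm.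
rewrite /G /lift_cochain /= map_cat /= !map_mask map_drop map_rcons map_mask sm.
by rewrite (nth_map (0, 0)).
Qed.

(** * The Balavoine product *)

Section Graded.
Context (K : fieldType) (E : gradedSpace K).

Lemma gproj_support (x : E) :
  exists r : seq int, forall d, d \notin r -> gproj E d x = 0.
Proof.
have /finite_fsetP[A eA] := gproj_finite x.
exists (enum_fset A) => d dA; apply/eqP; apply: contraNT dA => dx.
have : [set` A]%classic d by rewrite -eA.
by [].
Qed.

Lemma parity_partE (b : bool) (r : seq int) (x : E) :
  uniq r -> (forall d, d \notin r -> gproj E d x = 0) ->
  parity_part b x = \sum_(d <- r | parity d == b) gproj E d x.
Proof.
move=> ur xr; rewrite bigfs //; last by move=> d _; apply: xr.
by apply: eq_fsbigl; apply/seteqP; split => d /eqP.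
Qed.

Lemma parity_part_linear (b : bool) : linear (@parity_part K E b).
Proof.
move=> a x y; have [r1 xr] := gproj_support x; have [r2 yr] := gproj_support y.
(* A common finite support turns the three sums into sums over one list. *)
have out d : d \notin undup (r1 ++ r2) -> gproj E d x = 0 /\ gproj E d y = 0.
  by rewrite mem_undup mem_cat negb_or => /andP[/xr ? /yr ?].
have pE z : (forall d, d \notin undup (r1 ++ r2) -> gproj E d z = 0) -> _ :=
  @parity_partE b _ z (undup_uniq (r1 ++ r2)).
rewrite !pE; try by move=> d /out[].
  by rewrite scaler_sumr -big_split /=; apply: eq_bigr => d _; rewrite linearP.
by move=> d /out[e1 e2]; rewrite linearP e1 e2 scaler0 addr0.
Qed.

Lemma gproj_decomposition (x : E) : exists r : seq int, x = \sum_(d <- r) gproj E d x.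
Proof.
have [r xr] := gproj_support x; exists (undup r).
rewrite -{1}(gproj_sum x) [RHS]fsbig_seq ?undup_uniq //.
apply/esym/fsbig_widen => // d [_ /= dr].
by apply: xr; rewrite -mem_undup; apply/negP.
Qed.

Lemma homog_gproj (d : int) (x : E) : homog d (gproj E d x).
Proof. by rewrite /homog gproj_ortho eqxx. Qed.

Lemma homogD (d : int) (x y : E) : homog d x -> homog d y -> homog d (x + y).
Proof. by rewrite /homog linearD => /eqP -> /eqP ->. Qed.

Lemma homogZ (d : int) (a : K) (x : E) : homog d x -> homog d (a *: x).
Proof. by rewrite /homog linearZ /= => /eqP ->. Qed.

Lemma homog0 (d : int) : homog d (0 : E).
Proof. by rewrite /homog linear0. Qed.

Definition lhomog (w : seq (int * E)) : bool := all (fun x => homog x.1 x.2) w.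

Lemma homogs_lhomog (w : seq (int * E)) : homogs (map fst w) (map snd w) = lhomog w.
Proof. by rewrite /homogs; elim: w => //= x w ->. Qed.

Lemma homogsP (ds : seq int) (v : seq E) :
  homogs ds v -> exists2 w, lhomog w & ds = map fst w /\ v = map snd w.
Proof.
move=> hv; have sdv : size ds = size v by move: hv; rewrite /homogs all2E => /andP[/eqP].
have e1 : map fst (zip ds v) = ds by rewrite -/unzip1 unzip1_zip ?sdv.
have e2 : map snd (zip ds v) = v by rewrite -/unzip2 unzip2_zip ?sdv.
by exists (zip ds v); rewrite ?e1 ?e2 // -homogs_lhomog e1 e2.
Qed.

End Graded.

Section Multilinear.
Context (K : fieldType) (E : gradedSpace K) (F : lmodType K).
Implicit Types f : seq E -> F.

Lemma multilinear_sum f (s t : seq E) (I : Type) (r : seq I) (h : I -> E) :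
  multilinear f -> f (s ++ (\sum_(i <- r) h i) :: t) = \sum_(i <- r) f (s ++ h i :: t).
Proof.
move=> fL; elim: r => [|i r IH].
  by rewrite !big_nil (multilinear0 fL) // mem_cat inE eqxx orbT.
by rewrite !big_cons -IH -[h i in LHS]scale1r fL scale1r.
Qed.

(** The arguments are split from left to right into homogeneous components, the generalised prefix
    [s] holding those already treated. Identities of multilinear maps are thereby reduced to
    homogeneous lists, where [insertion] computes the product. *)
Lemma multilinear_ext0 f (v : seq E) : multilinear f ->
  (forall w, lhomog w -> size w = size v -> f (map snd w) = 0) -> f v = 0.
Proof.
move=> fL; rewrite -[v]cat0s -[[::]]/(map snd ([::] : seq (int * E))).
have : @lhomog K E [::] by [].
move: [::] => s; elim: v s => [|x v IH] s hs fw.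
  by rewrite cats0 fw // cats0 size_map.
have [r ->] := gproj_decomposition x; rewrite multilinear_sum // big1 // => d _.
rewrite -cat_rcons -(map_rcons snd s (d, _)); apply: IH => [|w hw sw].
  by rewrite /lhomog all_rcons /= homog_gproj.
by apply: fw; rewrite // sw !size_cat !size_map size_rcons /= addSnnS.
Qed.

Lemma multilinear_ext f f' (v : seq E) : multilinear f -> multilinear f' ->
  (forall w, lhomog w -> size w = size v -> f (map snd w) = f' (map snd w)) -> f v = f' v.
Proof.
move=> fL fL' ff'; apply/eqP; rewrite -subr_eq0; apply/eqP.
apply: (@multilinear_ext0 (fun v => f v - f' v)); last by move=> w hw sw; rewrite ff' ?subrr.
by move=> s t a x y; rewrite fL fL' scalerBr opprD addrACA.
Qed.

Lemma multilinearD f f' : multilinear f -> multilinear f' ->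
  multilinear (fun v => f v + f' v).
Proof. by move=> fL fL' s t a x y; rewrite fL fL' scalerDr addrACA. Qed.

Lemma multilinearZ (b : K) f : multilinear f -> multilinear (fun v => b *: f v).
Proof. by move=> fL s t a x y; rewrite fL scalerDr !scalerA mulrC. Qed.

Lemma multilinear_big (I : Type) (r : seq I) (f : I -> seq E -> F) :
  (forall i, multilinear (f i)) -> multilinear (fun v => \sum_(i <- r) f i v).
Proof.
move=> fL s t a x y; rewrite scaler_sumr -big_split /=.
by apply: eq_bigr => i _; apply: fL.
Qed.

Lemma lift_multilinear f : multilinear f -> lmultilinear (lift_cochain f).
Proof. by move=> fL s t d a x y; rewrite /lift_cochain !map_cat /= fL. Qed.

Lemma multi_extE (T : seq bool -> seq E -> F) (n : nat) (v : seq E) : size v = n ->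
  multi_ext T v =
  \sum_(p : n.-tuple bool) T p [seq parity_part bx.1 bx.2 | bx <- zip p v].
Proof. by move=> <-. Qed.

Lemma multi_ext_multilinear (T : seq bool -> seq E -> F) :
  (forall p s t a x y, size p = (size s + (size t).+1)%N ->
     T p (s ++ (a *: x + y) :: t) = a *: T p (s ++ x :: t) + T p (s ++ y :: t)) ->
  multilinear (multi_ext T).
Proof.
move=> TL s t a x y.
rewrite !(@multi_extE T (size s + (size t).+1)) ?size_cat //.
rewrite scaler_sumr -big_split /=; apply: eq_bigr => p _.
have szp := size_tuple p; move: (tval p) szp => {}p szp.
have szs : size (take (size s) p) = size s by rewrite size_takel // szp leq_addr.
have : size (drop (size s) p) = (size t).+1 by rewrite size_drop szp addKn.
move: szs (cat_take_drop (size s) p).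
move: (take _ _) (drop _ _) => p1 [|b p2] //= szs pE [sz2]; subst p.
rewrite !zip_cat // !map_cat /= parity_part_linear.
by rewrite TL // szp !size_map !size_zip szs sz2 !minnn.
Qed.

End Multilinear.

Section Circ.
Context (K : fieldType) (E : gradedSpace K).
Implicit Types f g h : seq E -> E.

Lemma circ_insertion n f g (w : seq (int * E)) :
  multilinear f -> multilinear g -> lhomog w ->
  balavoine_circ n f g (map snd w) = insertion n (lift_cochain g) (lift_cochain f) w.
Proof.
move=> fL gL; rewrite -homogs_lhomog => hw.
by rewrite (balavoine_circ_homog _ fL gL hw) -map_comp balavoine_formula_insertion.
Qed.

Lemma circ_multilinear n f g : multilinear f -> multilinear g ->
  multilinear (balavoine_circ n f g).
Proof.
move=> fL gL; apply: multi_ext_multilinear => p s t a x y szp.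
(* Degrees 0 and 1 realise any parities [p], so each summand of the extension is an insertion, even
   if the arguments are not homogeneous of these degrees. *)
pose ds := map (fun b : bool => (b : nat)%:Z) p.
have pE : p = map parity ds by rewrite -map_comp -[LHS]map_id; apply: eq_map => -[].
have szd : size ds = (size s + (size t).+1)%N by rewrite size_map.
have szs : size (take (size s) ds) = size s by rewrite size_takel // szd leq_addr.
have formulaE v : size v = size ds -> balavoine_formula n f g p v =
    insertion n (lift_cochain g) (lift_cochain f) (zip ds v).
  move=> szv; rewrite -balavoine_formula_insertion pE.
  by rewrite (map_comp parity fst) -/unzip1 -/unzip2 unzip1_zip ?unzip2_zip ?szv.
rewrite !formulaE ?size_cat ?szd //.
have : size (drop (size s) ds) = (size t).+1 by rewrite size_drop szd addKn.
move: szs (cat_take_drop (size s) ds); move: (take _ _) (drop _ _) => d1 [|d d2] // sz1 <- _.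
rewrite !zip_cat //=.
by rewrite insertion_multilinear //; apply: lift_multilinear.
Qed.

Lemma lift_homog n f (w : seq (int * E)) : is_cochain n f -> lhomog w ->
  homog (n + \sum_(x <- w) x.1) (f (map snd w)).
Proof.
by case=> _ _ fH; rewrite -homogs_lhomog => /fH; rewrite big_map.
Qed.

Lemma lhomog_inserted n g (A B C w : seq (int * E)) : is_cochain n g -> lhomog w ->
  perm_eq (A ++ B ++ C) w ->
  lhomog (A ++ (n + \sum_(x <- B) x.1, lift_cochain g B) :: C).
Proof.
move=> gC hw ABC; have : lhomog (A ++ B ++ C) by rewrite /lhomog (perm_all _ ABC).
rewrite /lhomog !all_cat /= => /and3P[-> hB ->]; rewrite andbT.
exact: lift_homog.
Qed.

Lemma circ_cochain m n f g : is_cochain m f -> is_cochain n g ->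
  is_cochain (m + n) (balavoine_circ n f g).
Proof.
move=> fC gC; have [_ fL _] := fC; have [_ gL _] := gC; split.
- rewrite /balavoine_circ /multi_ext big1 // => p _.
  by rewrite (tuple0 p) /balavoine_formula big_ord0.
- exact: circ_multilinear.
move=> ds v /homogsP[w hw [-> ->]]; rewrite circ_insertion // big_map.
(* A relation that ignores its second argument makes [insertion_rel] an induction principle for a
   predicate. *)
have := @insertion_rel K E E E E (fun y _ => homog (m + n + \sum_(x <- w) x.1) y)
  (homog0 _ _) (fun _ _ _ _ => @homogD _ _ _ _ _) (fun _ _ _ => @homogZ _ _ _ _ _)
  id n (lift_cochain g) (lift_cochain g) (lift_cochain f) (lift_cochain f) w.
apply=> A B C ABC _.
have hABC := lhomog_inserted gC hw ABC.
have := lift_homog fC hABC; congr (homog _ _).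
by rewrite -(perm_big _ ABC) !big_cat big_cons /= !addrA; congr (_ + _ + _); apply: addrAC.
Qed.

End Circ.

Section InsertionSum.
Context (K : fieldType) (E F : lmodType K).

Lemma insertion_pre0 n g (w : seq (int * E)) :
  insertion n g (fun=> 0) w = 0 :> F.
Proof. by elim: w n g => //= x w IH n g; rewrite !IH scaler0 !addr0. Qed.

Lemma insertion_fun0 n (phi : seq (int * E) -> F) w :
  lmultilinear phi -> insertion n (fun=> 0) phi w = 0.
Proof.
move=> phiL; rewrite -[RHS](scale0r (insertion n (fun=> 0) phi w)) -insertion_funZ //.
by congr insertion; apply/funext => u; rewrite scaler0.
Qed.

Lemma insertion_suml (I : Type) (r : seq I) (c : I -> K)
    (phi : I -> seq (int * E) -> F) n g w :
  insertion n g (fun u => \sum_(i <- r) c i *: phi i u) w =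
  \sum_(i <- r) c i *: insertion n g (phi i) w.
Proof.
elim: r => [|i r IH].
  rewrite big_nil -[RHS](insertion_pre0 n g w).
  by congr insertion; apply/funext => u; rewrite big_nil.
rewrite big_cons -IH -insertion_linearl.
by congr insertion; apply/funext => u; rewrite big_cons.
Qed.

Lemma insertion_sumr (I : Type) (r : seq I) (c : I -> K)
    (g : I -> seq (int * E) -> E) n (phi : seq (int * E) -> F) w : lmultilinear phi ->
  insertion n (fun u => \sum_(i <- r) c i *: g i u) phi w =
  \sum_(i <- r) c i *: insertion n (g i) phi w.
Proof.
move=> phiL; elim: r => [|i r IH].
  rewrite big_nil -[RHS](insertion_fun0 n w phiL).
  by congr insertion; apply/funext => u; rewrite big_nil.
rewrite big_cons -IH -insertion_linearr //.
by congr insertion; apply/funext => u; rewrite big_cons.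
Qed.

End InsertionSum.

Section CircLaws.
Context (K : fieldType) (E : gradedSpace K).
Implicit Types f g h : seq E -> E.

(** A nonempty block is replaced by one homogeneous entry, so [phi] only meets homogeneous lists no
    longer than [w]. This covers nested products, which are insertions on homogeneous lists only,
    and truncated series, which agree up to a given length only. *)
Lemma insertion_eq (F : lmodType K) n (g g' : seq (int * E) -> E)
    (phi phi' : seq (int * E) -> F) w :
  lhomog w ->
  (forall u, lhomog u -> homog (n + \sum_(x <- u) x.1) (g u)) ->
  (forall u, lhomog u -> (size u <= size w)%N -> phi u = phi' u) ->
  (forall u, lhomog u -> (size u <= size w)%N -> g u = g' u) ->
  insertion n g phi w = insertion n g' phi' w.
Proof.
move=> hw gH phi_eq g_eq.
have mid s : map (fun x : int * E => (x.1, x.2)) s = s by elim: s => //= -[? ?] s ->.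
rewrite -[in RHS](mid w).
apply: (@insertion_rel K E E F F eq _ _ _ id) => //=.
- by move=> ? ? ? ? -> ->.
- by move=> ? ? ? ->.
move=> A B C ABC B0; rewrite !mid.
have := hw; rewrite /lhomog -(perm_all _ ABC) !all_cat => /and3P[hA hB hC].
have sw := perm_size ABC; rewrite !size_cat in sw.
rewrite -g_eq //; last by rewrite -sw addnCA leq_addr.
apply: phi_eq; first by rewrite /lhomog all_cat /= hA hC gH.
by rewrite -sw size_cat /= addnS -addSn -addn1 -addnA leq_add2l leq_add2r.
Qed.

Lemma circ_eq n f f' g g' v :
  multilinear f -> multilinear f' -> is_cochain n g -> multilinear g' ->
  (forall u, (size u <= size v)%N -> f u = f' u) ->
  (forall u, (size u <= size v)%N -> g u = g' u) ->
  balavoine_circ n f g v = balavoine_circ n f' g' v.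
Proof.
move=> fL fL' gC gL' ff' gg'; have [_ gL _] := gC.
apply: multilinear_ext; try exact: circ_multilinear.
move=> w hw sw; rewrite !circ_insertion //; apply: insertion_eq => // u hu.
- exact: lift_homog.
- by rewrite sw => su; apply: ff'; rewrite size_map.
- by rewrite sw => su; apply: gg'; rewrite size_map.
Qed.

Lemma circ_suml (I : Type) (r : seq I) (c : I -> K) (f : I -> seq E -> E) n g v :
  (forall i, multilinear (f i)) -> multilinear g ->
  balavoine_circ n (fun u => \sum_(i <- r) c i *: f i u) g v =
  \sum_(i <- r) c i *: balavoine_circ n (f i) g v.
Proof.
move=> fL gL; have cfL i : multilinear (fun u => c i *: f i u) by apply: multilinearZ.
have sL := multilinear_big r cfL.
apply: (multilinear_ext (f' := fun v => \sum_(i <- r) c i *: balavoine_circ n (f i) g v)).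
- exact: circ_multilinear.
- by apply: multilinear_big => i; apply/multilinearZ/circ_multilinear.
move=> w hw _; rewrite circ_insertion //.
under [RHS]eq_bigr do rewrite circ_insertion //.
exact: insertion_suml.
Qed.

Lemma circ_sumr (I : Type) (r : seq I) (c : I -> K) (g : I -> seq E -> E) n f v :
  (forall i, multilinear (g i)) -> multilinear f ->
  balavoine_circ n f (fun u => \sum_(i <- r) c i *: g i u) v =
  \sum_(i <- r) c i *: balavoine_circ n f (g i) v.
Proof.
move=> gL fL; have cgL i : multilinear (fun u => c i *: g i u) by apply: multilinearZ.
have sL := multilinear_big r cgL.
apply: (multilinear_ext (f' := fun v => \sum_(i <- r) c i *: balavoine_circ n f (g i) v)).
- exact: circ_multilinear.
- by apply: multilinear_big => i; apply/multilinearZ/circ_multilinear.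
move=> w hw _; rewrite circ_insertion //.
under [RHS]eq_bigr do rewrite circ_insertion //.
by apply: insertion_sumr; apply: lift_multilinear.
Qed.

Lemma circ_preLie m n (phi f g : seq E -> E) v :
  multilinear phi -> is_cochain m f -> is_cochain n g ->
  balavoine_circ n (balavoine_circ m phi f) g v
    - balavoine_circ (m + n) phi (balavoine_circ n f g) v =
  ksign K m n *: (balavoine_circ m (balavoine_circ n phi g) f v
    - balavoine_circ (n + m) phi (balavoine_circ m g f) v).
Proof.
move=> phiL fC gC; have [_ fL _] := fC; have [_ gL _] := gC.
pose A m f n g v := balavoine_circ n (balavoine_circ m phi f) g v
    - balavoine_circ (m + n) phi (balavoine_circ n f g) v.
have AL m' f' n' g' : multilinear f' -> multilinear g' -> multilinear (A m' f' n' g').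
  move=> fL' gL'; rewrite /A => s t a x y.
  rewrite !(circ_multilinear n' (circ_multilinear m' phiL fL') gL').
  rewrite !(circ_multilinear (m' + n') phiL (circ_multilinear n' fL' gL')).
  by rewrite scalerBr opprD addrACA.
have AE m' f' n' g' w : is_cochain m' f' -> is_cochain n' g' -> lhomog w ->
    A m' f' n' g' (map snd w) =
    insertion_assoc m' (lift_cochain f') n' (lift_cochain g') (lift_cochain phi) w.
  move=> fC' gC' hw; have [_ fL' _] := fC'; have [_ gL' _] := gC'.
  have fgL := circ_multilinear n' fL' gL'; have pfL := circ_multilinear m' phiL fL'.
  rewrite /A !circ_insertion //; congr (_ - _); apply: insertion_eq => // u hu.
  - exact: lift_homog.
  - by move=> _; rewrite [LHS]circ_insertion.
  - exact: (lift_homog (circ_cochain fC' gC')).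
  - by move=> _; rewrite [LHS]circ_insertion.
rewrite -/(A m f n g v) -/(A n g m f v).
apply: (multilinear_ext (f' := fun v => ksign K m n *: A n g m f v)).
- exact: AL.
- exact/multilinearZ/AL.
move=> w hw _; rewrite !AE //; apply: insertion_preLie; exact: lift_multilinear.
Qed.

End CircLaws.

(** * Twisting a Maurer-Cartan element *)

Section Deformation.
Context (K : fieldType) (E : gradedSpace K) (T : seq E -> E).
Hypothesis TC : is_cochain 0 T.
Implicit Types f g h : seq E -> E.

Let TL : multilinear T. Proof. by case: TC. Qed.

Lemma cochain_multilinear n f : is_cochain n f -> multilinear f.
Proof. by case. Qed.

Lemma cochain_sum (I : Type) (r : seq I) (c : I -> K) (f : I -> seq E -> E) n :
  (forall i, is_cochain n (f i)) -> is_cochain n (fun u => \sum_(i <- r) c i *: f i u).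
Proof.
move=> fC; split.
- by rewrite big1 // => i _; have [-> _ _] := fC i; rewrite scaler0.
- by apply: multilinear_big => i; apply/multilinearZ/(cochain_multilinear (fC i)).
move=> ds v hv; apply: (big_ind (fun x : E => homog (n + \sum_(d <- ds) d) x)).
- exact: homog0.
- by move=> x y; apply: homogD.
by move=> i _; have [_ _ fH] := fC i; apply/homogZ/fH.
Qed.

Lemma cochainD n f g : is_cochain n f -> is_cochain n g -> is_cochain n (fun u => f u + g u).
Proof.
move=> [f0 fL fH] [g0 gL gH]; split; first by rewrite f0 g0 addr0.
  exact: multilinearD.
by move=> ds v hv; apply: homogD; [apply: fH|apply: gH].
Qed.

Lemma cochainZ n a f : is_cochain n f -> is_cochain n (fun u => a *: f u).
Proof.
move=> [f0 fL fH]; split; first by rewrite f0 scaler0.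
  exact: multilinearZ.
by move=> ds v hv; apply/homogZ/fH.
Qed.

Lemma bracket10E f v :
  balavoine_bracket 1 0 f T v = balavoine_circ 0 f T v - balavoine_circ 1 T f v.
Proof. by rewrite /balavoine_bracket /= scale1r. Qed.

Lemma bracket20E f v :
  balavoine_bracket 2 0 f T v = balavoine_circ 0 f T v - balavoine_circ 2 T f v.
Proof. by rewrite /balavoine_bracket /= scale1r. Qed.

Lemma bracket11E f g v :
  balavoine_bracket 1 1 f g v = balavoine_circ 1 f g v + balavoine_circ 1 g f v.
Proof. by rewrite /balavoine_bracket /= scaleN1r opprK. Qed.

Lemma bracket10_cochain f : is_cochain 1 f -> is_cochain 1 (balavoine_bracket 1 0 f T).
Proof.
move=> fC; rewrite (_ : balavoine_bracket 1 0 f T =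
  (fun v => balavoine_circ 0 f T v + (-1) *: balavoine_circ 1 T f v)).
  exact: cochainD (circ_cochain fC TC) (cochainZ (-1) (circ_cochain TC fC)).
by apply/funext => v; rewrite bracket10E scaleN1r.
Qed.

Lemma bracket10Z a f v : is_cochain 1 f ->
  balavoine_bracket 1 0 (fun u => a *: f u) T v = a *: balavoine_bracket 1 0 f T v.
Proof.
move=> /cochain_multilinear fL.
have eZ : (fun u => a *: f u) = (fun u => \sum_(i <- [:: tt]) a *: f u).
  by apply/funext => u; rewrite big_seq1.
by rewrite !bracket10E eZ circ_suml // circ_sumr // !big_seq1 scalerBr.
Qed.

Lemma bracket11_suml (I : Type) (r : seq I) (c : I -> K) (f : I -> seq E -> E) g v :
  (forall i, multilinear (f i)) -> multilinear g ->
  balavoine_bracket 1 1 (fun u => \sum_(i <- r) c i *: f i u) g v =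
  \sum_(i <- r) c i *: balavoine_bracket 1 1 (f i) g v.
Proof.
move=> fL gL; rewrite bracket11E circ_suml // circ_sumr // -big_split /=.
by apply: eq_bigr => i _; rewrite -scalerDr bracket11E.
Qed.

Lemma bracket11C f g v : balavoine_bracket 1 1 f g v = balavoine_bracket 1 1 g f v.
Proof. by rewrite !bracket11E addrC. Qed.

Lemma bracket11Zl a f g v : multilinear f -> multilinear g ->
  balavoine_bracket 1 1 (fun u => a *: f u) g v = a *: balavoine_bracket 1 1 f g v.
Proof.
move=> fL gL; have := @bracket11_suml _ [:: tt] (fun=> a) (fun=> f) g v (fun=> fL) gL.
rewrite big_seq1 => <-; congr balavoine_bracket; apply/funext => u.
by rewrite big_seq1.
Qed.

Lemma bracket20_sum (I : Type) (r : seq I) (c : I -> K) (f : I -> seq E -> E) v :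
  (forall i, multilinear (f i)) ->
  balavoine_bracket 2 0 (fun u => \sum_(i <- r) c i *: f i u) T v =
  \sum_(i <- r) c i *: balavoine_bracket 2 0 (f i) T v.
Proof.
move=> fL; rewrite bracket20E circ_suml // circ_sumr // -sumrB.
by apply: eq_bigr => i _; rewrite -scalerBr bracket20E.
Qed.

Lemma bracket11_cochain f g : is_cochain 1 f -> is_cochain 1 g ->
  is_cochain 2 (balavoine_bracket 1 1 f g).
Proof.
move=> fC gC; rewrite (_ : balavoine_bracket 1 1 f g =
  (fun v => balavoine_circ 1 f g v + balavoine_circ 1 g f v)).
  exact: cochainD (circ_cochain fC gC) (circ_cochain gC fC).
by apply/funext => v; rewrite bracket11E.
Qed.

(* The terms [T o (f o g)] and [T o (g o f)] recombine because the associator of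
   [T, f, g] is antisymmetric in the odd maps [f] and [g]. *)
Lemma bracket_derivation f g v : is_cochain 1 f -> is_cochain 1 g ->
  balavoine_bracket 2 0 (balavoine_bracket 1 1 f g) T v =
  balavoine_bracket 1 1 (balavoine_bracket 1 0 f T) g v +
  balavoine_bracket 1 1 f (balavoine_bracket 1 0 g T) v.
Proof.
move=> fC gC; have fL := cochain_multilinear fC; have gL := cochain_multilinear gC.
have two (p q : seq E -> E) : (fun u => p u + q u) =
    (fun u => \sum_(i <- [:: true; false]) 1 *: (if i then p else q) u).
  by apply/funext => u; rewrite big_cons big_seq1 !scale1r.
have twoN (p q : seq E -> E) : (fun u => p u - q u) =
    (fun u => \sum_(i <- [:: true; false]) (if i then 1 else -1) *: (if i then p else q) u).
  by apply/funext => u; rewrite big_cons big_seq1 scale1r scaleN1r.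
have circDl n p q h : multilinear p -> multilinear q -> multilinear h ->
    balavoine_circ n (fun u => p u + q u) h v = balavoine_circ n p h v + balavoine_circ n q h v.
  by move=> pL qL hL; rewrite two circ_suml ?big_cons ?big_nil ?addr0 ?scale1r //; case.
have circDr n p q h : multilinear p -> multilinear q -> multilinear h ->
    balavoine_circ n h (fun u => p u + q u) v = balavoine_circ n h p v + balavoine_circ n h q v.
  by move=> pL qL hL; rewrite two circ_sumr ?big_cons ?big_nil ?addr0 ?scale1r //; case.
have circBl n p q h : multilinear p -> multilinear q -> multilinear h ->
    balavoine_circ n (fun u => p u - q u) h v = balavoine_circ n p h v - balavoine_circ n q h v.
  by move=> pL qL hL; rewrite twoN circ_suml ?big_cons ?big_nil ?addr0 ?scale1r ?scaleN1r //; case.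
have circBr n p q h : multilinear p -> multilinear q -> multilinear h ->
    balavoine_circ n h (fun u => p u - q u) v = balavoine_circ n h p v - balavoine_circ n h q v.
  by move=> pL qL hL; rewrite twoN circ_sumr ?big_cons ?big_nil ?addr0 ?scale1r ?scaleN1r //; case.
have bracketE p q : is_cochain 1 p -> is_cochain 1 q ->
    balavoine_bracket 1 1 (balavoine_bracket 1 0 p T) q v =
    (balavoine_circ 1 (balavoine_circ 0 p T) q v - balavoine_circ 1 (balavoine_circ 1 T p) q v)
    + (balavoine_circ 1 q (balavoine_circ 0 p T) v
       - balavoine_circ 1 q (balavoine_circ 1 T p) v).
  move=> /cochain_multilinear pL /cochain_multilinear qL.
  have -> : balavoine_bracket 1 0 p T =
      (fun v => balavoine_circ 0 p T v - balavoine_circ 1 T p v).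
    by apply/funext => u; rewrite bracket10E.
  by rewrite bracket11E circBl ?circBr //; apply: circ_multilinear.
rewrite [balavoine_bracket 1 1 f _ v]bracket11C !bracketE // {bracketE}.
have -> : balavoine_bracket 1 1 f g = (fun v => balavoine_circ 1 f g v + balavoine_circ 1 g f v).
  by apply/funext => u; rewrite bracket11E.
rewrite bracket20E circDl ?circDr //; do ?exact: circ_multilinear.
(* As [T] has degree 0, exchanging it with an odd map in the associator costs no sign. *)
have /eqP := circ_preLie v fL gC TC; have /eqP := circ_preLie v gL fC TC.
have preT :
    balavoine_circ 2 T (balavoine_circ 1 f g) v + balavoine_circ 2 T (balavoine_circ 1 g f) v =
    balavoine_circ 1 (balavoine_circ 1 T f) g v + balavoine_circ 1 (balavoine_circ 1 T g) f v.
  apply/eqP; rewrite eq_sym -subr_eq0 opprD addrACA.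
  have := circ_preLie v TL fC gC; rewrite /ksign expr1 scaleN1r => ->.
  by rewrite addNr.
rewrite preT /ksign /= expr0 !scale1r !subr_eq => /eqP -> /eqP ->.
rewrite !opprD !addrA.
by rewrite [LHS](ACl (1*7*6*5*4*8*3*2)).
Qed.

Lemma iter_bracket_cochain (D : seq E -> E) r : is_cochain 1 D ->
  is_cochain 1 (iter r (fun D' => balavoine_bracket 1 0 D' T) D).
Proof. by move=> DC; elim: r => [|r IH] //=; apply: bracket10_cochain. Qed.

(** * The exponential series of a Maurer-Cartan element *)

Section MaurerCartan.
Context (charK0 : [pchar K] =i pred0) (D : seq E -> E).
Hypothesis DMC : is_MC D.

Let DC : is_cochain 1 D. Proof. by case: DMC. Qed.

Let d (r : nat) : seq E -> E := iter r (fun D' => balavoine_bracket 1 0 D' T) D.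
Let e (r : nat) : seq E -> E := fun v => (r`!%:R)^-1 *: d r v.

Let natK (n : nat) : (n.+1%:R : K) != 0.
Proof. by rewrite (pcharf0P K).1. Qed.

Let dC r : is_cochain 1 (d r).
Proof. exact: iter_bracket_cochain. Qed.

Let eC r : is_cochain 1 (e r).
Proof. exact/cochainZ/dC. Qed.

Let eL r : multilinear (e r). Proof. exact: cochain_multilinear (eC r). Qed.

(** The [e r] are divided powers of the bracket with [T]; characteristic 0 makes [r.+1]
    invertible. *)
Let bracket_e r : balavoine_bracket 1 0 (e r) T = fun v => r.+1%:R *: e r.+1 v.
Proof.
apply/funext => v; rewrite bracket10Z; last exact: dC.
by rewrite scalerA factS natrM invfM mulVKf.
Qed.

(* [(k + 1) S_(k+1) = [S_k, T]] for [S_k := \sum_(i + j = k) [e_i, e_j]]. *)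
Let sum_bracket_e k v : \sum_(i < k.+1) balavoine_bracket 1 1 (e i) (e (k - i)) v = 0.
Proof.
elim: k v => [|k IH] v.
  rewrite big_ord1 /=; have [_ DD] := DMC.
  have -> : e 0 = D by apply/funext => u; rewrite /e /= invr1 scale1r.
  exact: DD.
apply: (scalerI (natK k)); rewrite scaler0 scaler_sumr.
(* The factor [k + 1] is split as [i + (k + 1 - i)]. By [bracket_e] the two parts arise from
   bracketing [T] with the left and with the right factor. *)
transitivity (\sum_(i < k.+2) (i%:R *: balavoine_bracket 1 1 (e i) (e (k.+1 - i)) v
    + (k.+1 - i)%:R *: balavoine_bracket 1 1 (e i) (e (k.+1 - i)) v)).
  by apply: eq_bigr => i _; rewrite -scalerDl -natrD subnKC // -ltnS.
rewrite big_split /= big_ord_recl [X in _ + X]big_ord_recr /= subnn !scale0r add0r addr0.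
rewrite -big_split /=.
transitivity (balavoine_bracket 2 0
  (fun u => \sum_(i < k.+1) 1 *: balavoine_bracket 1 1 (e i) (e (k - i)) u) T v); last first.
  have -> : (fun u => \sum_(i < k.+1) 1 *: balavoine_bracket 1 1 (e i) (e (k - i)) u) =
      (fun=> 0).
    apply/funext => u; rewrite -[RHS](IH u); apply: eq_bigr => i _.
    by rewrite scale1r.
  have -> : (fun _ : seq E => 0 : E) = (fun u => \sum_(i <- ([::] : seq unit)) 1 *: T u).
    by apply/funext => u; rewrite big_nil.
  by rewrite bracket20_sum // big_nil.
rewrite bracket20_sum; last first.
  by move=> i; apply: cochain_multilinear (bracket11_cochain (eC _) (eC _)).
apply: eq_bigr => i _; rewrite scale1r bracket_derivation // !bracket_e.
rewrite [balavoine_bracket 1 1 (e i) (fun v => _ *: _) v]bracket11C.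
rewrite (bracket11Zl _ v (eL i.+1) (eL (k - i))) (bracket11Zl _ v (eL (k - i).+1) (eL i)).
by rewrite [balavoine_bracket 1 1 (e (k - i).+1) _ v]bracket11C /bump add1n subSS subSn // -ltnS.
Qed.

Lemma exp_bracketE N v : (forall r, (N <= r)%N -> d r v = 0) ->
  exp_bracket T D v = \sum_(r < N) e r v.
Proof.
move=> dN; rewrite (fsbig_ord _ N (fun r => e r v)) /exp_bracket.
apply/esym/fsbig_widen => // r [_ /= /negP]; rewrite -leqNgt => /dN dr.
by rewrite /e -/(d r v) dr scaler0.
Qed.

(** The bound depends only on the number of arguments, so one truncation of the series serves all
    lists up to a given length. It is supplied by [extend0_nilpotent]. *)
Hypothesis d_nilpotent : forall r v, (size v + 2 <= r)%N -> d r v = 0.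

Lemma exp_bracket_sum N v : (size v + 2 <= N)%N -> exp_bracket T D v = \sum_(r < N) e r v.
Proof.
by move=> vN; apply: exp_bracketE => r Nr; apply: d_nilpotent; apply: leq_trans Nr.
Qed.

Lemma exp_bracket_cochain : is_cochain 1 (exp_bracket T D).
Proof.
have C N := @cochain_sum _ (index_enum 'I_N) (fun r => (r`!%:R)^-1) (fun r => d r) 1
  (fun r => dC r).
split.
- by rewrite (@exp_bracket_sum 2) //; have [-> _ _] := C 2.
- move=> s t a x y; have [_ CL _] := C (size s + (size t).+1 + 2)%N.
  rewrite !(@exp_bracket_sum (size s + (size t).+1 + 2)) ?size_cat //; exact: CL.
move=> ds v hv; rewrite (exp_bracket_sum (leqnn _)).
by have [_ _ CH] := C (size v + 2)%N; apply: CH.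
Qed.

(** The series is truncated at [n + n] terms. A bracket of [e j] and [e i] with [i + j >= n + n] has
    an index at least [n] and vanishes on [v] by locality. The remaining triangle is a sum of the
    [S_k], which are zero by [sum_bracket_e]. *)
Lemma exp_bracket_MC : is_MC (exp_bracket T D).
Proof.
split=> [|v]; first exact: exp_bracket_cochain.
pose n := (size v + 2)%N.
have eL2 N : multilinear (fun u => \sum_(r < N) 1 *: e r u).
  by apply: multilinear_big => i; apply/multilinearZ.
have XE u : (size u <= size v)%N -> exp_bracket T D u = \sum_(r < n + n) 1 *: e r u.
  move=> uv; under [RHS]eq_bigr do rewrite scale1r.
  by apply: exp_bracket_sum; rewrite /n; lia.
have XC := exp_bracket_cochain; have XL := cochain_multilinear XC.
rewrite bracket11E (circ_eq XL (eL2 _) XC (eL2 _) XE XE) -bracket11E.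
rewrite bracket11_suml //.
have e0 r u : (size u <= size v)%N -> (n <= r)%N -> e r u = 0.
  by move=> uv nr; rewrite /e d_nilpotent ?scaler0 //; rewrite /n in nr; lia.
have zL : multilinear (fun _ : seq E => 0 : E) by move=> s t a x y; rewrite scaler0 addr0.
have b0 r s : (n <= r)%N -> balavoine_bracket 1 1 (e r) (e s) v = 0.
  move=> nr; rewrite bracket11E.
  rewrite (circ_eq (eL r) zL (eC s) (eL s) (fun u uv => e0 r u uv nr) (fun _ _ => erefl)).
  rewrite (circ_eq (eL s) (eL s) (eC r) zL (fun _ _ => erefl) (fun u uv => e0 r u uv nr)).
  have eZ : (fun _ : seq E => 0 : E) = (fun u => \sum_(i <- [::]) 1 *: e i u).
    by apply/funext => u; rewrite big_nil.
  by rewrite eZ circ_suml // circ_sumr // !big_nil addr0.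
transitivity (\sum_(i < n + n) \sum_(j < n + n) balavoine_bracket 1 1 (e j) (e i) v).
  apply: eq_bigr => i _; rewrite scale1r bracket11C bracket11_suml //.
  by apply: eq_bigr => j _; rewrite scale1r.
transitivity (\sum_(i < n + n) \sum_(j < n + n - i) balavoine_bracket 1 1 (e j) (e i) v).
  apply: eq_bigr => i _.
  rewrite (big_ord_widen _ (fun j => balavoine_bracket 1 1 (e j) (e i) v) (leq_subr i (n + n))).
  rewrite [LHS](bigID (fun j : 'I_(n + n) => (j < n + n - i)%N)) /= [X in _ + X]big1 ?addr0 //.
  move=> j; rewrite -leqNgt => ij; case: (leqP n j) => [|jn]; first exact: b0.
  by rewrite bracket11C b0 //; lia.
rewrite (exchange_triangle _ (fun j i => balavoine_bracket 1 1 (e j) (e i) v)).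
by rewrite big1 // => k _; apply: sum_bracket_e.
Qed.

End MaurerCartan.
End Deformation.

(** * Naturality and strict morphisms *)

Section Natural.
Context (K : fieldType) (E E' : gradedSpace K) (h : E -> E').
Hypotheses (hL : linear h) (hH : forall d x, homog d x -> homog d (h x)).

Lemma linear_fun0 (F F' : lmodType K) (k : F -> F') : linear k -> k 0 = 0.
Proof.
by move=> kL; have := kL (-1) 0 0; rewrite scaler0 addr0 scaleN1r addNr.
Qed.

(** As [h] preserves degrees, the same signs occur on both sides; [insertion_rel] for the graph of
    [h] compares the summands. *)
Lemma circ_natural n (f g : seq E -> E) (f' g' : seq E' -> E') (v : seq E) :
  multilinear f -> multilinear g -> multilinear f' -> multilinear g' ->
  (forall u, f' (map h u) = h (f u)) -> (forall u, g' (map h u) = h (g u)) ->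
  balavoine_circ n f' g' (map h v) = h (balavoine_circ n f g v).
Proof.
move=> fL gL fL' gL' f'h g'h.
have hD x y : h (x + y) = h x + h y by rewrite -[x]scale1r hL !scale1r.
have h0 := linear_fun0 hL.
have hZ a x : h (a *: x) = a *: h x by rewrite -[a *: x]addr0 hL h0 addr0.
apply: (multilinear_ext (f := fun v => balavoine_circ n f' g' (map h v))
  (f' := fun v => h (balavoine_circ n f g v))).
- by move=> s t a x y; rewrite !map_cat /= hL (circ_multilinear n fL' gL').
- by move=> s t a x y; rewrite (circ_multilinear n fL gL) hL.
move=> w hw _; pose H := map (fun x : int * E => (x.1, h x.2)).
have mapH u : map h (map snd u) = map snd (H u) by rewrite -!map_comp.
have hHw : lhomog (H w).
  by rewrite /lhomog all_map; apply: sub_all hw => x; apply: hH.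
rewrite mapH !circ_insertion //.
apply: (@insertion_rel K E E' E E' (fun y y' => y' = h y)) => //.
- by move=> x x' y y' -> ->; rewrite hD.
- by move=> a x x' ->; rewrite hZ.
move=> A B C _ _; rewrite /lift_cochain !map_cat /= -f'h map_cat /=; congr f'.
by rewrite -!map_comp; congr (_ ++ _ :: _); rewrite -g'h -map_comp.
Qed.

Lemma iter_bracket_natural (T D : seq E -> E) (T' D' : seq E' -> E') r v :
  is_cochain 0 T -> is_cochain 1 D -> is_cochain 0 T' -> is_cochain 1 D' ->
  (forall u, T' (map h u) = h (T u)) -> (forall u, D' (map h u) = h (D u)) ->
  iter r (fun D => balavoine_bracket 1 0 D T') D' (map h v) =
  h (iter r (fun D => balavoine_bracket 1 0 D T) D v).
Proof.
move=> TC DC TC' DC' Th Dh; elim: r v => [|r IH] v //=.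
have dL := cochain_multilinear (iter_bracket_cochain TC r DC).
have dL' := cochain_multilinear (iter_bracket_cochain TC' r DC').
have TL := cochain_multilinear TC; have TL' := cochain_multilinear TC'.
rewrite !bracket10E (circ_natural _ _ dL TL dL' TL' IH Th).
rewrite (circ_natural _ _ TL dL TL' dL' Th IH).
by rewrite addrC -scaleN1r -hL scaleN1r addrC.
Qed.

End Natural.

Lemma strict_family_multilinear (K : fieldType) (A B : gradedSpace K) (a : A -> B) :
  linear a -> multilinear (strict_family a).
Proof.
by move=> aL [|z [|z2 s]] [|z' t] c x y //=; rewrite ?aL ?scaler0 ?addr0.
Qed.

(** * Strict families as homomorphisms *)

Section StrictMorphisms.
Context (K : fieldType) (A : gradedSpace K).

Lemma insertion_pre_eq0 (F : lmodType K) n g (phi : seq (int * A) -> F) w :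
  (forall u, (0 < size u)%N -> phi u = 0) -> insertion n g phi w = 0.
Proof.
elim: w n g phi => //= x w IH n g phi phi0.
by rewrite phi0 // !IH ?scaler0 ?addr0 // => u u0; apply: phi0.
Qed.

(** Since [phi] accepts one argument only, the sole surviving term is the one where [g] absorbs the
    whole list. *)
Lemma insertion_strict (F : lmodType K) n g (phi : seq (int * A) -> F) w :
  (forall u, size u != 1%N -> phi u = 0) -> (0 < size w)%N ->
  insertion n g phi w = phi [:: (n + \sum_(x <- w) x.1, g w)].
Proof.
move=> phi0; elim: w n g => // x [|y w] IH n g _.
  by rewrite /= scaler0 !addr0 big_seq1.
rewrite [LHS]/= -/(insertion _ _ _ (y :: w)) phi0 // add0r big_cons addrA.
rewrite -(IH _ (fun u => g (x :: u))) //=.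
rewrite [X in _ + X](_ : _ = 0) ?addr0 //.
apply/eqP; rewrite scaler_eq0; apply/orP; right; apply/eqP.
apply: (@insertion_pre_eq0 _ n g (fun u => phi (x :: u)) (y :: w)) => u u0.
by apply: phi0; case: u u0.
Qed.

Lemma balavoine_formula_strict (B : gradedSpace K) n (a : A -> B) (g : seq A -> A) ds v :
  size ds = size v -> (0 < size v)%N ->
  balavoine_formula n (strict_family a) g (map parity ds) v = a (g v).
Proof.
move=> szd v0.
have -> : map parity ds = map (fun x => parity x.1) (zip ds v).
  by rewrite (map_comp parity fst) -/unzip1 unzip1_zip ?szd.
have vE : map snd (zip ds v) = v by rewrite -/unzip2 unzip2_zip ?szd.
rewrite -{2}vE balavoine_formula_insertion insertion_strict.
- by rewrite /lift_cochain /= vE.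
- by case=> [|x [|y u]].
by rewrite size_zip szd minnn.
Qed.

Lemma reshape_ones (T : Type) (s : seq T) :
  reshape (nseq (size s) 1%N) s = [seq [:: x] | x <- s].
Proof. by elim: s => [|x s IH] //; rewrite [RHS]/= -IH /= take0 drop0. Qed.

Lemma permvals1 n : permvals (1%g : 'S_n) = iota 0 n.
Proof. by rewrite -val_enum_ord; apply: eq_map => i; rewrite perm1. Qed.

Lemma koszul1 n p : koszul K (1%g : 'S_n) p = 1.
Proof.
rewrite /koszul big1 // => i _; rewrite big1 // => j /andP[ij].
by rewrite !perm1 ltnNge ltnW.
Qed.

(** In blocks of size one every value is a last value, so the values of [s] increase. *)
Lemma Eshuffle_ones n (s : 'S_n) : Eshuffle (nseq n 1%N) s = (s == 1%g).
Proof.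
have e : reshape (nseq n 1%N) (permvals s) = [seq [:: x] | x <- permvals s].
  by rewrite -{1}(size_permvals s) reshape_ones.
rewrite /Eshuffle /shuffle e all_map (@eq_all _ _ xpredT) // all_predT /=.
rewrite -map_comp map_id; apply/idP/eqP => [ss|->]; last by rewrite permvals1 iota_ltn_sorted.
apply: permvals_inj; rewrite permvals1.
apply: (irr_sorted_eq ltn_trans ltnn) => //; first exact: iota_ltn_sorted.
exact: perm_mem (permvals_perm s).
Qed.

Lemma size_reshape_mem (T : eqType) (sh : seq nat) (s : seq T) (i : nat) :
  sumn sh = size s -> i \in sh -> exists2 b, b \in reshape sh s & size b = i.
Proof.
elim: sh s => //= j sh IH s szs; rewrite inE => /orP[/eqP ->|ish].
  by exists (take j s); rewrite ?mem_head // size_takel // -szs leq_addr.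
have [|b bs bi] := IH (drop j s) _ ish; first by rewrite size_drop -szs addKn.
by exists b; rewrite // inE bs orbT.
Qed.

(** A block of size other than one is sent to 0 and kills its term. Only [q = n] with blocks of size
    one survives, and there the identity is the only shuffle by [Eshuffle_ones]. *)
Lemma infty_comp_formula_strict (B : gradedSpace K) (F : lmodType K) (h : seq B -> F)
    (a : A -> B) p (v : seq A) :
  multilinear h -> (0 < size v)%N ->
  infty_comp_formula h (strict_family a) p v = h (map a v).
Proof.
move=> hL v0; rewrite /infty_comp_formula; set n := size v.
have term0 q (k : q.-tuple 'I_n.+1) (s : 'S_n) :
    sumn (map val k) == n -> map val k != nseq q 1%N ->
    h (map (strict_family a) (reshape (map val k) (permseq 0 s v))) = 0.
  move=> /eqP sk kN; apply: multilinear0 => //.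
  have szl : size (permseq 0 s v) = n by rewrite size_map size_permvals.
  have : ~~ all (pred1 1%N) (map val k).
    apply: contra kN => /all_pred1P; rewrite size_map size_tuple => ->.
    by [].
  case/allPn => i ik i1; have [b bin bi] := size_reshape_mem (etrans sk (esym szl)) ik.
  apply/mapP; exists b => //; rewrite /= in i1; rewrite -bi in i1.
  by case: b i1 {bin bi} => [|x [|y b]].
have ones_sum q : sumn (nseq q 1%N) = q by rewrite sumn_nseq mul1n.
rewrite big_nat_recr //= big_nat big1 ?add0r; last first.
  move=> q /andP[_ qn]; rewrite big1 // => k /andP[sk _]; rewrite big1 // => s _.
  rewrite term0 ?scaler0 //; apply: contraTneq sk => ->.
  by rewrite ones_sum neq_ltn qn.
(* [inord 1] has value 1 because [n] is positive. *)
have vk0 : map val (nseq_tuple n (inord 1 : 'I_n.+1)) = nseq n 1%N.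
  by rewrite /= map_nseq; congr nseq; apply: inordK.
rewrite (bigD1 (nseq_tuple n (inord 1 : 'I_n.+1))) /=; last first.
  rewrite -/(tval (nseq_tuple n _)) vk0 ones_sum eqxx /=.
  by rewrite all_nseq inordK ?orbT.
rewrite [X in _ + X]big1 ?addr0; last first.
  move=> k /andP[/andP[sk _] kN]; rewrite big1 // => s _.
  rewrite term0 ?scaler0 //; apply: contra kN => /eqP; rewrite -vk0 => /inj_map kk.
  by apply/eqP/val_inj/kk; apply: val_inj.
rewrite -/(tval (nseq_tuple n _)) vk0.
rewrite (big_pred1 1%g); last by move=> s; apply: Eshuffle_ones.
rewrite koszul1 scale1r; congr h.
have -> : permseq 0 (1%g : 'S_n) v = v.
  by rewrite /permseq permvals1 map_nth_iota0 ?take_size.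
by rewrite reshape_ones -map_comp.
Qed.

Lemma strict_family_cochain (B : gradedSpace K) (a : A -> B) :
  linear a -> (forall d x, homog d x -> homog d (a x)) -> is_cochain 0 (strict_family a).
Proof.
move=> aL aH; split=> //; first exact: strict_family_multilinear.
move=> ds [|x [|y v]] hv; try exact: homog0.
case: ds hv => [|d [|d' ds]] //; rewrite /homogs /= ?andbF // andbT add0r big_seq1.
exact: aH.
Qed.

Lemma infty_comp_strict (B C : gradedSpace K) (b : B -> C) (a : A -> B) :
  linear b -> linear a ->
  infty_comp (strict_family b) (strict_family a) = strict_family (b \o a).
Proof.
move=> bL aL; apply/funext => v; have sbL := strict_family_multilinear bL.
have baL : linear (b \o a) by move=> c x y; rewrite /= aL bL.
(* On the empty list the range of [q] is empty, matching the default value 0 of [strict_family]. *)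
have formula0 p w : (0 < size w)%N = false ->
    infty_comp_formula (strict_family b) (strict_family a) p w = 0.
  by case: w => // _; rewrite /infty_comp_formula big_geq.
have formulaE p w : infty_comp_formula (strict_family b) (strict_family a) p w =
    strict_family (b \o a) w.
  case: (posnP (size w)) => [w0|w0]; last first.
    by rewrite infty_comp_formula_strict //; case: w w0 => [|x [|y w]].
  by rewrite formula0 ?w0 //; case: w w0.
apply: multilinear_ext; last 1 first.
- move=> w hw _; rewrite /infty_comp -homogs_lhomog in hw *.
  rewrite (multi_ext_homog _ hw) ?formulaE // => p u u0; rewrite formulaE.
  exact: multilinear0 (strict_family_multilinear baL) u0.
- apply: multi_ext_multilinear => p s t c x y _; rewrite !formulaE.
  exact: strict_family_multilinear.
exact: strict_family_multilinear.
Qed.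

End StrictMorphisms.

(** * Homotopy embedding tensors *)

Section Nilpotency.
Context (K : fieldType) (g V : gradedSpace K) (Theta : seq V -> g).
Hypothesis ThetaC : is_cochain 0 Theta.
Let E := gsum g V.
Let T : seq E -> E := extend0 Theta.

Lemma homog_gsum (d : int) (x : E) : homog d x = homog d x.1 && homog d x.2.
Proof. by case: x => x u; rewrite /homog /= /gsum_proj /= xpair_eqE. Qed.

Lemma extend0_cochain : is_cochain 0 T.
Proof.
have [T0 TL TH] := ThetaC; split.
- by rewrite /T /extend0 /= T0.
- move=> s t a x y; rewrite /T /extend0 !map_cat /= TL.
  by congr pair; rewrite /= scaler0 addr0.
move=> ds w hw; rewrite homog_gsum homog0 andbT; apply: TH.
move: hw; rewrite /homogs; elim: ds w => [|d ds IH] [|x w] //= /andP[hx /IH ->].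
by move: hx; rewrite homog_gsum => /andP[_ ->].
Qed.

Let TL : multilinear T. Proof. exact: cochain_multilinear extend0_cochain. Qed.

Lemma extend0_eq0 (w : seq E) : has (fun x => x.2 == 0) w -> T w = 0.
Proof.
case/hasP => x xw /eqP x0; have [_ ThetaL _] := ThetaC.
by rewrite /T /extend0 (multilinear0 ThetaL) // -x0; apply: map_f.
Qed.

(* [T] replaces at least one entry outside of [g] by an entry in [g]; hence
   inserting [T] repeatedly ends up in [0]. *)
Definition rep_count (w : seq (int * E)) : nat := count (fun x => x.2.2 != 0) w.

(** A block with an entry of zero [V]-component is killed by [T]. Any other block [B] becomes an
    entry of [g], which lowers [rep_count] by [size B], at least 1. [P] will be the vanishing of the
    value or of its [V]-component. *)
Lemma circ_extend0_vanish (P : E -> Prop) (f : seq E -> E) r w :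
  P 0 -> (forall x y, P x -> P y -> P (x + y)) -> (forall a x, P x -> P (a *: x)) ->
  multilinear f ->
  (forall u, lhomog u -> (rep_count u < r)%N -> P (f (map snd u))) ->
  lhomog w -> (rep_count w < r.+1)%N -> P (balavoine_circ 0 f T (map snd w)).
Proof.
move=> P0 PD PZ fL fP hw wr; rewrite circ_insertion //.
have PD' : forall x x' y y' : E, P x -> P y -> P (x + y) by move=> x _ y _; apply: PD.
have PZ' : forall (a : K) (x x' : E), P x -> P (a *: x) by move=> a x _; apply: PZ.
apply: (@insertion_rel K E E E E (fun y _ => P y) P0 PD' PZ' id 0
  (lift_cochain T) (lift_cochain T) (lift_cochain f) (lift_cochain f)).
move=> A B C ABC B0; case: (boolP (has (fun x => x.2.2 == 0) B)) => [B2|].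
  rewrite /lift_cochain [T _]extend0_eq0 ?has_map // map_cat.
  by rewrite (multilinear0 fL) // mem_cat inE eqxx orbT.
rewrite -all_predC => B2; apply: fP; first exact: lhomog_inserted extend0_cochain hw ABC.
have cB : rep_count B = size B by apply/eqP; rewrite -all_count.
have := seq.permP ABC (fun x => x.2.2 != 0); rewrite -/(rep_count w) !count_cat.
rewrite -/(rep_count A) -/(rep_count B) -/(rep_count C) cB => wE.
rewrite /rep_count count_cat /= eqxx -/(rep_count A) -/(rep_count C); lia.
Qed.

(** Each summand feeds [T] a value of [h] on a block of [w]; a zero [V]-component there makes [T]
    vanish. *)
Lemma extend0_circ_vanish n (h : seq E -> E) w : is_cochain n h -> lhomog w ->
  (forall u, lhomog u -> (rep_count u <= rep_count w)%N -> (h (map snd u)).2 = 0) ->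
  balavoine_circ n T h (map snd w) = 0.
Proof.
move=> hC hw h0; have hL := cochain_multilinear hC; rewrite circ_insertion //.
have PD' : forall x x' y y' : E, x = 0 -> y = 0 -> x + y = 0.
  by move=> x _ y _ -> ->; rewrite addr0.
have PZ' : forall (a : K) (x x' : E), x = 0 -> a *: x = 0.
  by move=> a x _ ->; rewrite scaler0.
apply: (@insertion_rel K E E E E (fun y _ => y = 0) erefl PD' PZ' id n
  (lift_cochain h) (lift_cochain h) (lift_cochain T) (lift_cochain T)).
move=> A B C ABC B0; rewrite /lift_cochain extend0_eq0 // map_cat has_cat /= h0 ?eqxx ?orbT //.
  by have := hw; rewrite /lhomog -(perm_all _ ABC) !all_cat => /and3P[].
by rewrite /rep_count -(seq.permP ABC) !count_cat addnCA leq_addr.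
Qed.

Lemma extend0_circ_snd n (h : seq E -> E) v : multilinear h ->
  (balavoine_circ n T h v).2 = 0.
Proof.
move=> hL; apply: (multilinear_ext0 (f := fun v => (balavoine_circ n T h v).2)).
  by move=> s t a x y; rewrite (circ_multilinear n TL hL).
move=> w hw _; rewrite circ_insertion //.
have PD' : forall x x' y y' : E, x.2 = 0 -> y.2 = 0 -> (x + y).2 = 0.
  by move=> x _ y _ /= -> ->; rewrite addr0.
have PZ' : forall (a : K) (x x' : E), x.2 = 0 -> (a *: x).2 = 0.
  by move=> a x _ /= ->; rewrite scaler0.
exact: (@insertion_rel K E E E E (fun y _ => y.2 = 0) erefl PD' PZ' id n
  (lift_cochain h) (lift_cochain h) (lift_cochain T) (lift_cochain T)).
Qed.

Variable D : seq E -> E.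
Hypothesis DC : is_cochain 1 D.
Let d (r : nat) : seq E -> E := iter r (fun D' => balavoine_bracket 1 0 D' T) D.

Let dC r : is_cochain 1 (d r).
Proof. exact: (iter_bracket_cochain extend0_cochain r DC). Qed.

Let d_snd r w : lhomog w -> (rep_count w < r)%N -> (d r (map snd w)).2 = 0.
Proof.
elim: r w => [|r IH] w // hw wr.
rewrite -[d r.+1 _]/(balavoine_bracket 1 0 (d r) T _) bracket10E.
have -> : forall x y : E, (x - y).2 = x.2 - y.2 by [].
rewrite extend0_circ_snd ?subr0; last exact: cochain_multilinear (dC r).
apply: (@circ_extend0_vanish (fun x => x.2 = 0) _ r) => //.
- by move=> x y /= -> ->; rewrite addr0.
- by move=> a x /= ->; rewrite scaler0.
- exact: cochain_multilinear (dC r).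
Qed.

(** One step more than in [d_snd]: once the [V]-component of [d r] is gone, [T o d r] vanishes too,
    and [d r o T] is handled by induction as [T] lowers [rep_count]. *)
Let d_eq0 r w : lhomog w -> ((rep_count w).+1 < r)%N -> d r (map snd w) = 0.
Proof.
elim: r w => [|r IH] w // hw wr.
rewrite -[d r.+1 _]/(balavoine_bracket 1 0 (d r) T _) bracket10E.
rewrite (extend0_circ_vanish (dC r)) ?subr0 //; last first.
  by move=> u hu uw; apply: d_snd => //; exact: leq_ltn_trans uw wr.
case: r IH wr => // r IH wr.
apply: (@circ_extend0_vanish (fun x => x = 0) _ r) => //.
- by move=> x y -> ->; rewrite addr0.
- by move=> a x ->; rewrite scaler0.
- exact: cochain_multilinear (dC r.+1).
Qed.

Lemma extend0_nilpotent r v : (size v + 2 <= r)%N ->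
  iter r (fun D' => balavoine_bracket 1 0 D' T) D v = 0.
Proof.
move=> vr; apply: (multilinear_ext0 (cochain_multilinear (dC r))) => w hw sw.
apply: d_eq0 => //; have := count_size (fun x : int * E => x.2.2 != 0) w.
by rewrite -/(rep_count w) sw; lia.
Qed.

End Nilpotency.

(** * The induced structure and the functor *)

Section Twisting.
Context (K : fieldType) (charK0 : [pchar K] =i pred0) (g : LInfty K) (V : LInftyRep g).
Implicit Types Theta : embeddingTensor V.

Let D : seq (gsum g V) -> gsum g V := boxplus (@linf_op K g) (@rep_op K g V).

Let DC : is_cochain 1 D. Proof. by case: (rep_leibniz V). Qed.

Lemma twisted_sum Theta N v : (size v + 2 <= N)%N ->
  twisted Theta v = \sum_(r < N) (r`!%:R)^-1 *:
    iter r (fun D' => balavoine_bracket 1 0 D' (extend0 Theta)) D v.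
Proof.
move=> vN; apply: exp_bracket_sum vN => //.
move=> r u; apply: (extend0_nilpotent (et_cochain Theta) DC).
Qed.

Lemma twisted_MC Theta : is_MC (twisted Theta).
Proof.
have TC := extend0_cochain (et_cochain Theta).
apply: (exp_bracket_MC TC charK0 (rep_leibniz V)) => r u.
exact: (extend0_nilpotent (et_cochain Theta) DC).
Qed.

Lemma inV_linear : linear (@inV K g V).
Proof. by move=> a x y; rewrite /inV; congr pair; rewrite /= scaler0 addr0. Qed.

Lemma inV_homog d (u : V) : homog d (inV g u) = homog d u.
Proof. by rewrite homog_gsum homog0. Qed.

(** The equation of a homotopy embedding tensor says that the [g]-component vanishes on [V], so [V]
    is closed under the twisted structure. *)
Lemma inV_induced_op Theta v :
  inV g (induced_op Theta v) = twisted Theta (map (@inV K g V) v).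
Proof.
have := et_eq Theta v; rewrite /projh /inV /induced_op => e.
by rewrite [RHS]surjective_pairing e.
Qed.

Lemma induced_op_cochain Theta : is_cochain 1 (induced_op Theta).
Proof.
have [[T0 TL TH] _] := twisted_MC Theta; split.
- by rewrite /induced_op /= T0.
- by move=> s t a x y; rewrite /induced_op !map_cat /= inV_linear TL.
move=> ds v hv; rewrite -inV_homog inV_induced_op; apply: TH.
move: hv; rewrite /homogs; elim: ds v => [|d ds IH] [|x v] //= /andP[hx /IH ->].
by rewrite inV_homog hx.
Qed.

(** [inV] intertwines the two structures, so by naturality it maps the bracket of [induced_op] to
    that of [twisted], which is zero; the second component gives the claim. *)
Lemma induced_op_MC Theta : is_MC (induced_op Theta).
Proof.
have [TC TT] := twisted_MC Theta; have IC := induced_op_cochain Theta.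
have TL := cochain_multilinear TC; have IL := cochain_multilinear IC.
split=> // v.
have hH d (u : V) : homog d u -> homog d (inV g u) by rewrite inV_homog.
have tI u : twisted Theta (map (@inV K g V) u) = inV g (induced_op Theta u).
  by rewrite inV_induced_op.
have := TT (map (@inV K g V) v); rewrite !bracket11E.
rewrite (circ_natural inV_linear hH 1 v IL IL TL TL tI tI).
by move=> /(congr1 snd).
Qed.

Section Morphism.
Context (Theta' Theta : embeddingTensor V) (phi : (g -> g) * (V -> V)).
Hypothesis phiP : is_et_hom Theta' Theta phi.

Let h (x : gsum g V) : gsum g V := (phi.1 x.1, phi.2 x.2).

Let hL : linear h.
Proof.
by move=> a x y; rewrite /h /= (eth_linear1 phiP) (eth_linear2 phiP).
Qed.

Let hH d x : homog d x -> homog d (h x).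
Proof.
rewrite !homog_gsum => /andP[/(eth_degree1 phiP) e1 /(eth_degree2 phiP) e2].
by rewrite /h /= e1 e2.
Qed.

(** [h] intertwines the structures [D] and the tensors, hence all iterated brackets. Both lists have
    the same length, so a common truncation allows a termwise comparison. *)
Lemma twisted_natural v : twisted Theta (map h v) = h (twisted Theta' v).
Proof.
have TC := extend0_cochain (et_cochain Theta).
have TC' := extend0_cochain (et_cochain Theta').
have Dh u : D (map h u) = h (D u).
  case: u => [|z u]; first by rewrite /D /h /= (linear_fun0 (eth_linear1 phiP))
    (linear_fun0 (eth_linear2 phiP)).
  rewrite /D /boxplus /h /=; rewrite (eth_linf phiP) (eth_rep phiP) /=.
  by rewrite -!map_comp belast_map last_map -map_comp.
have Th u : extend0 Theta (map h u) = h (extend0 Theta' u).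
  rewrite /extend0 /h /= (eth_tensor phiP) (linear_fun0 (eth_linear2 phiP)).
  by rewrite -!map_comp.
rewrite !(@twisted_sum _ (size v + 2)) ?size_map //.
have hD x y : h (x + y) = h x + h y by rewrite -[x]scale1r hL !scale1r.
have h0 := linear_fun0 hL.
rewrite (big_morph h hD h0); apply: eq_bigr => r _.
rewrite (iter_bracket_natural hL hH r v TC' DC TC DC Th Dh).
by rewrite -[_ *: iter _ _ _ v]addr0 hL h0 addr0.
Qed.

Lemma induced_op_natural v : phi.2 (induced_op Theta' v) = induced_op Theta (map phi.2 v).
Proof.
rewrite /induced_op; have := congr1 snd (twisted_natural (map (@inV K g V) v)).
rewrite /= => <-; congr (twisted Theta _).2; rewrite -!map_comp.
by apply: eq_map => u; rewrite /h /inV /= (linear_fun0 (eth_linear1 phiP)).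
Qed.

Lemma strict_is_infty_hom :
  @is_infty_hom K (LeibnizInfty (induced_op_MC Theta')) (LeibnizInfty (induced_op_MC Theta))
    (strict_family phi.2).
Proof.
have phiL := eth_linear2 phiP; split.
  by apply: strict_family_cochain => //; apply: eth_degree2 phiP.
move=> ds v v0 hv; rewrite balavoine_formula_strict //; last first.
  by move: hv; rewrite /homogs all2E => /andP[/eqP].
rewrite infty_comp_formula_strict //=; last exact: cochain_multilinear (induced_op_cochain _).
exact: induced_op_natural.
Qed.

End Morphism.
End Twisting.

Theorem theorem6p7 (K : fieldType) (charK0 : [pchar K] =i pred0)
    (g : LInfty K) (V : LInftyRep g) :
  (forall Theta : embeddingTensor V,
     is_MC (twisted Theta)
     /\ is_MC (induced_op Theta)
     /\ forall v : seq V,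
          inV g (induced_op Theta v) = twisted Theta (map (@inV K g V) v))
  /\ exists leibP : forall Theta : embeddingTensor V, is_MC (induced_op Theta),
       @is_functor (et_category V) (leibniz_category K)
         (fun Theta => LeibnizInfty (leibP Theta))
         (fun Theta' Theta phi => strict_family phi.2).
Proof.
split=> [Theta|].
  split; first exact: twisted_MC.
  by split; [apply: induced_op_MC|apply: inV_induced_op].
exists (@induced_op_MC K charK0 g V); split=> //=.
  by move=> Theta' Theta phi; apply: strict_is_infty_hom.
move=> x y z b a bP aP; rewrite infty_comp_strict //.
  exact: (eth_linear2 bP).
exact: (eth_linear2 aP).
Qed.
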